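(* Let $X,Y\in\mathbf{E}_*$, with $X$ cofibrant and $Y$ fibrant in $\mathbf{E}_*$. Then the natural map $$[X,Y]_{\mathbf{E}_*}\longrightarrow[X,Y]^{\mathbb{R}_+},$$ sending the homotopy class in $\mathbf{E}_*$ of a morphism $f$ to its exterior homotopy class under $\mathbb{R}_+$, is a bijection.
   Context: All topological spaces are compactly generated and weakly Hausdorff. An exterior space is a topological space $X$ with a nonempty family $\mathcal{E}$ of open subsets (exterior sets), closed under finite intersections and such that every open set containing a member of $\mathcal{E}$ is in $\mathcal{E}$. A continuous map is exterior if preimages of exterior sets are exterior. $\mathbf{E}$ is the (complete and cocomplete) category of exterior spaces and exterior maps. The cocompact externology consists of complements of closed compact subsets; $\mathbb{R}_+=[0,\infty)$ and $\mathbb{N}=\{0,1,2,\dots\}$ carry it. For an exterior space $X$ and a topological space $Y$, $X\bar\times Y$ is $X\times Y$ with exterior sets those open sets $W$ such that for each $y\in Y$ there are an exterior set $F$ of $X$ and an open neighbourhood $U$ of $y$ with $F\times U\subset W$. With $I=[0,1]$, an exterior homotopy is an exterior map $X\bar\times I\to Y$; $[X,Y]$ is the set of exterior homotopy classes. For $n\ge0$ put $\mathcal{S}^n=\mathbb{N}\bar\times S^n$, $\mathcal{D}^n=\mathbb{N}\bar\times D^n$, $\mathcal{C}^n=\mathbb{N}\bar\times(D^n\times I)$, $\mathcal{S}^{-1}=\varnothing$. A discrete ray is an exterior map $\alpha\colon\mathbb{N}\to X$; $\pi_n^e(X,\alpha)$ is the set of exterior homotopy classes relative to $\mathbb{N}$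 of exterior maps $g\colon\mathcal{S}^n\to X$ with $g(m,x_0)=\alpha(m)$ ($x_0\in S^n$ the base point), a group for $n\ge1$ in the usual sphere-wise way. The exterior model structure on $\mathbf{E}$ is the cofibrantly generated one with weak equivalences the exterior maps inducing a bijection on $[\mathbb{N},-]$ and isomorphisms on $\pi_n^e$ for all $n\ge1$ and all discrete rays, generating cofibrations $\{\mathcal{S}^{n-1}\to\mathcal{D}^n\}_{n\ge0}$ and generating trivial cofibrations $\{\mathcal{D}^n\to\mathcal{C}^n\}_{n\ge0}$. $\mathbf{E}_*$ has as objects diagrams $\mathbb{R}_+\xrightarrow{s}X\xrightarrow{r}\mathbb{R}_+$ in $\mathbf{E}$ with $rs=\mathrm{id}$, and as morphisms the exterior maps commuting with sections and retractions. Its model structure is the one in which a map is a fibration, cofibration or weak equivalence iff it is so in $\mathbf{E}$. For $X\in\mathbf{E}_*$ and a finite simplicial set $K$, $X\otimes_{\mathbb{R}_+}K$ is the pushout in $\mathbf{E}$ of $\mathbb{R}_+\leftarrow\mathbb{R}_+\bar\times|K|\to X\bar\times|K|$ (projection and $s\times\mathrm{id}$), with the evident section and retraction. The cylinder of $X$ is $X\otimes_{\mathbb{R}_+}\Delta[1]$, and two morphisms $f,g\colon X\to Y$ of $\mathbf{E}_*$ ($X$ cofibrant, $Y$ fibrant) are homotopic in $\mathbf{E}_*$ if there is a morphism $X\otimes_{\mathbb{R}_+}\Delta[1]\to Y$ in $\mathbf{E}_*$ restricting to $f$ and $g$ at the two ends; $[X,Y]_{\mathbf{E}_*}$ is the set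 of homotopy classes of morphisms of $\mathbf{E}_*$. $[X,Y]^{\mathbb{R}_+}$ is the set of exterior maps $X\to Y$ commuting with the sections (no condition on the retractions), modulo exterior homotopies $X\bar\times I\to Y$ all of whose stages commute with the sections. *)

(* Defs.v *)
From HB Require Import structures.
From mathcomp Require Import all_boot all_order all_algebra.
From mathcomp Require Import all_classical all_reals.
From mathcomp Require Import topology normedtype.

Set Implicit Arguments.
Unset Strict Implicit.
Unset Printing Implicit Defensive.

Import Order.TTheory GRing.Theory Num.Theory.
Import numFieldNormedType.Exports.

Local Open Scope classical_set_scope.
Local Open Scope ring_scope.

Definition compactly_generated (X : topologicalType) : Prop :=
  forall A : set X,
    (forall (K : topologicalType) (u : K -> X),
       compact [set: K] -> hausdorff_space K -> continuous u ->
       closed (u @^-1` A)) ->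
    closed A.

Definition weakly_hausdorff (X : topologicalType) : Prop :=
  forall (K : topologicalType) (u : K -> X),
    compact [set: K] -> hausdorff_space K -> continuous u -> closed (range u).

Lemma continuousC (X Y Z : topologicalType) (f : X -> Y) (g : Y -> Z) :
  continuous f -> continuous g -> continuous (g \o f).
Proof. by move=> cf cg x; apply: continuous_comp; [exact: cf|exact: cg]. Qed.

Lemma continuous_pre_closed (X Y : topologicalType) (f : X -> Y) (A : set Y) :
  continuous f -> closed A -> closed (f @^-1` A).
Proof. by move=> /continuous_closedP; apply. Qed.

Lemma continuous_pre_open (X Y : topologicalType) (f : X -> Y) (A : set Y) :
  continuous f -> open A -> open (f @^-1` A).
Proof. by move=> /continuousP; apply. Qed.

Lemma set_val_continuous (T : topologicalType) (A : set T) :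
  continuous (set_val : A -> T).
Proof. exact: (@initial_continuous A T set_val). Qed.

Lemma to_set_type_continuous (S T : topologicalType) (A : set T) (f : S -> A) :
  continuous (set_val \o f) -> continuous f.
Proof.
move=> cf; apply/continuousP => _ [B oB <-].
by rewrite -comp_preimage; exact: continuous_pre_open.
Qed.

Lemma compact_set_type (T : topologicalType) (A : set T) :
  compact A -> compact [set: A].
Proof.
move=> cA F FF _.
have FA : (set_val @ F) A.
  by apply: (@filterS _ F _ setT) => [x _|]; [exact: set_valP|exact: filterT].
have [p [Ap Fp]] := cA (set_val @ F) (fmap_proper_filter _ FF) FA.
exists (exist _ p (mem_set Ap)); split=> // B V FB.
rewrite nbhsE => -[W [[W' oW' <-] W'p] sWV].
have FB' : (set_val @ F) (set_val @` B).
  by apply: (@filterS _ F _ B) => // x Bx; exists x.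
have [|_ [[x Bx <-] W'x]] := Fp _ W' FB'; first exact: open_nbhs_nbhs.
by exists x; split=> //; exact: sWV.
Qed.

Lemma hausdorff_inj (S T : topologicalType) (f : S -> T) :
  continuous f -> injective f -> hausdorff_space T -> hausdorff_space S.
Proof.
move=> cf injf hT x y clxy; apply: injf; apply: hT => A B nA nB.
have [z [Az Bz]] := clxy _ _ (cf x _ nA) (cf y _ nB).
by exists (f z).
Qed.

Lemma hausdorff_set_type (T : topologicalType) (A : set T) :
  hausdorff_space T -> hausdorff_space A.
Proof.
apply: hausdorff_inj; first exact: set_val_continuous.
by move=> x y /val_inj.
Qed.

Lemma fst_continuous (S T : topologicalType) : continuous (@fst S T).
Proof. by move=> [x y]; exact: cvg_fst. Qed.

Lemma snd_continuous (S T : topologicalType) : continuous (@snd S T).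
Proof. by move=> [x y]; exact: cvg_snd. Qed.

Lemma pair_continuous (Z S T : topologicalType) (f : Z -> S) (g : Z -> T) :
  continuous f -> continuous g -> continuous (fun z => (f z, g z)).
Proof. by move=> cf cg z; apply: cvg_pair; [exact: cf|exact: cg]. Qed.

Lemma hausdorff_prod (S T : topologicalType) :
  hausdorff_space S -> hausdorff_space T -> hausdorff_space (S * T)%type.
Proof.
move=> hS hT p q cl; rewrite (surjective_pairing p) (surjective_pairing q).
congr pair.
- apply: hS => A B nA nB.
  have [z [Az Bz]] := cl _ _ (fst_continuous nA) (fst_continuous nB).
  by exists z.1.
- apply: hT => A B nA nB.
  have [z [Az Bz]] := cl _ _ (snd_continuous nA) (snd_continuous nB).
  by exists z.2.
Qed.

Lemma compact_prodT (S T : topologicalType) :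
  compact [set: S] -> compact [set: T] -> compact [set: S * T].
Proof. by rewrite -setXTT; exact: compact_setX. Qed.

Lemma open_tube (S T : topologicalType) (W : set (S * T)) :
  compact [set: T] -> open W -> open [set x | forall y, W (x, y)].
Proof.
rewrite compact_near_coveringP => cT oW; rewrite openE => x /= Wx.
have sub : \forall x' \near x, [set: T] `<=` (fun y => W (x', y)).
  apply: (cT S (nbhs x) (fun x' y => W (x', y)) _) => y _.
  have [[A B] /= [nA nB] sAB] := open_nbhs_nbhs (conj oW (Wx y)).
  by exists (B, A) => // -[y' x'] /= [? ?]; exact: sAB.
by apply: filterS sub => x' sx' y; exact: sx'.
Qed.

Lemma closed_proj1 (S T : topologicalType) (C : set (S * T)) :
  compact [set: T] -> closed C -> closed (fst @` C).
Proof.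
move=> cT cC; rewrite -openC.
rewrite (_ : ~` _ = [set x | forall y, (~` C) (x, y)]).
  by apply: open_tube => //; exact: closed_openC.
apply/seteqP; split=> [x nC y Cxy|x nC [[x' y] Cxy /= xx']].
  by apply: nC; exists (x, y).
by apply: (nC y); rewrite -xx'.
Qed.

(* In a compactly generated space, [weakly_hausdorff] amounts to the diagonal
   being closed in the compactly generated product. *)
Definition closed_equalizers (X : topologicalType) : Prop :=
  forall (K : topologicalType) (u v : K -> X),
    compact [set: K] -> hausdorff_space K -> continuous u -> continuous v ->
    closed [set k | u k = v k].

Lemma closed_equalizers_weakly_hausdorff (X : topologicalType) :
  compactly_generated X -> closed_equalizers X -> weakly_hausdorff X.
Proof.
move=> cgX ceX K u cK hK cu; apply: cgX => L v cL hL cv.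
rewrite (_ : _ @^-1` _ = fst @` [set p : L * K | v p.1 = u p.2]).
  apply: closed_proj1 => //.
  apply: (ceX (L * K)%type (v \o fst) (u \o snd)).
  - exact: compact_prodT.
  - exact: hausdorff_prod.
  - exact: continuousC (@fst_continuous _ _) cv.
  - exact: continuousC (@snd_continuous _ _) cu.
apply/seteqP; split=> [l [k _ ukvl]|l [[l' k] /= vluk <-]].
  by exists (l, k).
by exists k.
Qed.

Lemma weakly_hausdorff_closed1 (X : topologicalType) (x : X) :
  weakly_hausdorff X -> closed [set x].
Proof.
move=> whX; rewrite (_ : [set x] = range (fun _ : bool => x)).
  apply: whX.
  - exact: bool_compact.
  - exact: discrete_hausdorff.
  - by move=> y; exact: cvg_cst.
by apply/seteqP; split=> [_ ->|_ [_ _ <-]] //; exists true.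
Qed.

Lemma weakly_hausdorff_closed_equalizers (X : topologicalType) :
  weakly_hausdorff X -> closed_equalizers X.
Proof.
move=> whX K u v cK hK cu cv; rewrite -openC openE => k /= uvk.
have oU : open (u @^-1` (~` [set v k])).
  apply: continuous_pre_open => //.
  exact/closed_openC/weakly_hausdorff_closed1.
have nU : nbhs k (u @^-1` (~` [set v k])) by exact: open_nbhs_nbhs.
have [V nV sV] := @compact_regular K k setT hK cK filterT _ nU.
pose C := closure V.
have cC : closed (u @` C).
  rewrite (_ : u @` C = range (u \o (set_val : C -> K))).
    apply: whX.
    - apply/compact_set_type/(subclosed_compact _ cK) => //.
      exact: closed_closure.
    - exact: hausdorff_set_type.
    - exact: continuousC (@set_val_continuous _ _) cu.
  apply/seteqP; split=> [_ [c Cc <-]|_ [c _ <-]].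
    by exists (exist _ c (mem_set Cc)).
  by exists (set_val c) => //; exact: set_valP.
have nW : nbhs k (v @^-1` (~` (u @` C))).
  apply: open_nbhs_nbhs; split.
    by apply: continuous_pre_open => //; exact: closed_openC.
  by move=> [c /sV].
apply: filterS (filterI nV nW) => l [Vl nvl] uvl.
by apply: nvl; exists l => //; exact: subset_closure.
Qed.

Lemma compactly_generated_open (X : topologicalType) (A : set X) :
  compactly_generated X ->
  (forall (K : topologicalType) (u : K -> X),
     compact [set: K] -> hausdorff_space K -> continuous u ->
     open (u @^-1` A)) ->
  open A.
Proof.
move=> cgX oA; rewrite -closedC; apply: cgX => K u cK hK cu.
by rewrite preimage_setC; exact/open_closedC/oA.
Qed.

Lemma locally_compact_compactly_generated (X : topologicalType) :
  hausdorff_space X -> (forall x : X, exists2 C, nbhs x C & compact C) ->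
  compactly_generated X.
Proof.
move=> hX lcX A cA x clx; have [C nC cC] := lcX x.
suff clAC : closed (A `&` C).
  have /clAC[] // : closure (A `&` C) x.
  move=> B nB; have [y [Ay [By Cy]]] := clx _ (filterI nB nC).
  by exists y.
apply: compact_closed => //.
rewrite (_ : A `&` C = set_val @` ((set_val : C -> X) @^-1` A)).
  apply: continuous_compact.
    exact/continuous_subspaceT/set_val_continuous.
  apply: (subclosed_compact _ (compact_set_type cC)) => //.
  apply: cA; [exact: compact_set_type|exact: hausdorff_set_type|].
  exact: set_val_continuous.
apply/seteqP; split=> [y [Ay Cy]|_ [y Ay <-]].
  by exists (exist _ y (mem_set Cy)).
by split=> //; exact: set_valP.
Qed.

Lemma hausdorff_weakly_hausdorff (X : topologicalType) :
  hausdorff_space X -> weakly_hausdorff X.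
Proof.
move=> hX K u cK hK cu; apply: compact_closed => //.
by apply: continuous_compact => //; exact/continuous_subspaceT.
Qed.

Lemma compactly_generated_prod (X Y : topologicalType) :
  compactly_generated X -> compact [set: Y] -> hausdorff_space Y ->
  compactly_generated (X * Y)%type.
Proof.
move=> cgX cY hY.
suff H (W : set (X * Y)) : (forall (K : topologicalType) (u : K -> X * Y),
    compact [set: K] -> hausdorff_space K -> continuous u ->
    open (u @^-1` W)) -> open W.
  move=> A cA; rewrite -openC; apply: H => K u cK hK cu.
  by rewrite preimage_setC; exact/closed_openC/cA.
move=> oW; rewrite openE => -[x0 y0] W0.
have oWx : open ((fun y => (x0, y)) @^-1` W).
  apply: oW => //; apply: pair_continuous; last by move=> y; exact: cvg_id.
  by move=> y; exact: cvg_cst.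
have nWx : nbhs y0 ((fun y => (x0, y)) @^-1` W) by exact: open_nbhs_nbhs.
have [V nV sV] := @compact_regular Y y0 setT hY cY filterT _ nWx.
pose C := closure V.
have cC : compact [set: C].
  apply/compact_set_type/(subclosed_compact _ cY) => //.
  exact: closed_closure.
have oO : open [set x | forall c : C, W (x, set_val c)].
  apply: compactly_generated_open => // K u cK hK cu.
  apply: (@open_tube K C ((fun p => (u p.1, set_val p.2)) @^-1` W)) => //.
  apply: oW.
  - exact: compact_prodT.
  - by apply: hausdorff_prod => //; exact: hausdorff_set_type.
  - apply: pair_continuous.
      exact: continuousC (@fst_continuous _ _) cu.
    exact: continuousC (@snd_continuous _ _) (@set_val_continuous _ _).
exists ([set x | forall c : C, W (x, set_val c)], V).
  split=> //=; apply: open_nbhs_nbhs; split=> // c.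
  by apply: sV; exact: set_valP.
move=> [x y] /= [Wx Vy].
by have := Wx (exist _ y (mem_set (subset_closure Vy))).
Qed.

Lemma weakly_hausdorff_prod (X Y : topologicalType) :
  compactly_generated (X * Y)%type ->
  weakly_hausdorff X -> weakly_hausdorff Y -> weakly_hausdorff (X * Y)%type.
Proof.
move=> cgXY /weakly_hausdorff_closed_equalizers eX.
move=> /weakly_hausdorff_closed_equalizers eY.
apply: closed_equalizers_weakly_hausdorff => // K u v cK hK cu cv.
rewrite (_ : mkset _ = [set k | (fst \o u) k = (fst \o v) k] `&`
                       [set k | (snd \o u) k = (snd \o v) k]).
  by apply: closedI; [apply: eX|apply: eY] => //;
    (apply: continuousC; [|exact: fst_continuous]) ||
    (apply: continuousC; [|exact: snd_continuous]).
apply/seteqP; split=> [k /= -> //|k /= [e1 e2]].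
by rewrite (surjective_pairing (u k)) (surjective_pairing (v k)) e1 e2.
Qed.

Record extSpace := ExtSpace {
  ext_carrier :> topologicalType;
  exterior : set (set ext_carrier);
  exterior_nonempty : exists F, exterior F;
  exterior_open : forall F, exterior F -> open F;
  exteriorI : forall F G, exterior F -> exterior G -> exterior (F `&` G);
  exteriorS : forall F G, exterior F -> open G -> F `<=` G -> exterior G;
  ext_compactly_generated : compactly_generated ext_carrier;
  ext_weakly_hausdorff : weakly_hausdorff ext_carrier }.

Lemma exteriorT (X : extSpace) : exterior [set: X].
Proof. by have [F eF] := exterior_nonempty X; apply: exteriorS eF openT _. Qed.

Record extMap (X Y : extSpace) := ExtMap {
  ext_fun :> X -> Y;
  ext_fun_continuous : continuous ext_fun;
  ext_fun_exterior : forall F, exterior F -> exterior (ext_fun @^-1` F) }.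

Lemma id_continuous (T : topologicalType) : continuous (@id T).
Proof. by move=> x; exact: cvg_id. Qed.

Lemma ext_idP (X : extSpace) (F : set X) : exterior F -> exterior (id @^-1` F).
Proof. by []. Qed.

Definition ext_id (X : extSpace) : extMap X X :=
  ExtMap (@id_continuous X) (@ext_idP X).

Section Composition.
Variables (X Y Z : extSpace) (f : extMap X Y) (g : extMap Y Z).

Lemma ext_comp_continuous : continuous (g \o f).
Proof.
apply: (@continuousC _ _ _ f g); exact: ext_fun_continuous.
Qed.

Lemma ext_comp_exterior F : exterior F -> exterior ((g \o f) @^-1` F).
Proof.
by move=> eF; rewrite comp_preimage; do 2![apply: ext_fun_exterior].
Qed.

Definition ext_comp : extMap X Z := ExtMap ext_comp_continuous ext_comp_exterior.

End Composition.

Section Cocompact.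
Variable T : topologicalType.
Hypotheses (cgT : compactly_generated T) (whT : weakly_hausdorff T).

Definition cocompact : set (set T) :=
  [set F | exists K, [/\ closed K, compact K & F = ~` K]].

Lemma cocompact_nonempty : exists F, cocompact F.
Proof. by exists (~` set0), set0; split=> //; [exact: closed0|exact: compact0]. Qed.

Lemma cocompact_open F : cocompact F -> open F.
Proof. by move=> [K [cK _ ->]]; exact: closed_openC. Qed.

Lemma cocompactI F G : cocompact F -> cocompact G -> cocompact (F `&` G).
Proof.
move=> [K [cK kK ->]] [L [cL kL ->]]; exists (K `|` L).
by split; [exact: closedU|exact: compactU|rewrite setCU].
Qed.

Lemma cocompactS F G : cocompact F -> open G -> F `<=` G -> cocompact G.
Proof.
move=> [K [cK kK ->]] oG sKG; exists (~` G); split.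
- exact: open_closedC.
- apply: (subclosed_compact (open_closedC oG) kK).
  by rewrite -[K]setCK; exact: subsetC.
- by rewrite setCK.
Qed.

Definition cocompact_space : extSpace :=
  ExtSpace cocompact_nonempty cocompact_open cocompactI cocompactS cgT whT.

End Cocompact.

Lemma nat_compactly_generated : compactly_generated nat.
Proof.
apply: locally_compact_compactly_generated; first exact: discrete_hausdorff.
move=> n; exists [set n]; last exact: compact_set1.
by apply: open_nbhs_nbhs; split=> //; exact: discrete_open.
Qed.

Lemma nat_weakly_hausdorff : weakly_hausdorff nat.
Proof. exact/hausdorff_weakly_hausdorff/discrete_hausdorff. Qed.

Definition ext_nat : extSpace :=
  cocompact_space nat_compactly_generated nat_weakly_hausdorff.

Section HalfLine.
Variable R : realType.

Definition half_line : set R := `[0, +oo[%classic.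

Lemma half_line_hausdorff : hausdorff_space half_line.
Proof. by apply: hausdorff_set_type; exact: Rhausdorff. Qed.

Lemma half_line_compactly_generated : compactly_generated half_line.
Proof.
apply: (locally_compact_compactly_generated half_line_hausdorff) => x.
exists (set_val @^-1` `[set_val x - 1, set_val x + 1]%classic).
  apply: set_val_continuous; apply/nbhs_ballP; exists 1 => //= y.
  by rewrite /ball/= ltr_distlC in_itv/= => /andP[/ltW -> /ltW ->].
have cS : compact (half_line `&` `[set_val x - 1, set_val x + 1]).
  rewrite setIC; apply: compact_closedI; first exact: segment_compact.
  exact: interval_closed.
move=> F FF FA.
pose G : set_system R := set_val @ F.
have PG : ProperFilter G by exact: fmap_proper_filter.
have [|p [[p0 pS] Gp]] := cS G PG.
  apply: (@filterS _ F _ _ _ _ FA) => y Sy.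
  by split=> //; exact: set_valP.
exists (exist _ p (mem_set p0)); split=> // A B FA'.
rewrite nbhsE => -[W [[W' oW' <-] W'p] sWB].
have GA : G (set_val @` A).
  by apply: (@filterS _ F _ A) => // y Ay; exists y.
have [|_ [[y Ay <-] W'y]] := Gp _ W' GA; first exact: open_nbhs_nbhs.
by exists y; split=> //; exact: sWB.
Qed.

Definition Rplus : extSpace :=
  cocompact_space half_line_compactly_generated
    (hausdorff_weakly_hausdorff half_line_hausdorff).

End HalfLine.

Record compHausdorff := CompHausdorff {
  ch_carrier :> topologicalType;
  ch_compact : compact [set: ch_carrier];
  ch_hausdorff : hausdorff_space ch_carrier }.

Definition ch_prod (S T : compHausdorff) : compHausdorff :=
  CompHausdorff (compact_prodT (@ch_compact S) (@ch_compact T))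
    (hausdorff_prod (@ch_hausdorff S) (@ch_hausdorff T)).

Section BarProduct.
Variables (X : extSpace) (T : compHausdorff).

(* For a compact Hausdorff second factor the usual product topology is already
   compactly generated, hence is the product of compactly generated spaces. *)
Definition bar_exterior : set (set (X * T)) :=
  [set W | open W /\
    forall y : T, exists (F : set X) (U : set T),
      [/\ exterior F, open U, U y & F `*` U `<=` W]].

Lemma bar_exterior_nonempty : exists W, bar_exterior W.
Proof.
exists setT; split=> [|y]; first exact: openT.
by exists setT, setT; split=> //; [exact: exteriorT|exact: openT].
Qed.

Lemma bar_exterior_open W : bar_exterior W -> open W.
Proof. by case. Qed.

Lemma bar_exteriorI W W' :
  bar_exterior W -> bar_exterior W' -> bar_exterior (W `&` W').
Proof.
move=> [oW eW] [oW' eW']; split=> [|y]; first exact: openI.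
have [F [U [eF oU Uy sW]]] := eW y; have [G [V [eG oV Vy sW']]] := eW' y.
exists (F `&` G), (U `&` V); split.
- exact: exteriorI.
- exact: openI.
- by [].
- by move=> [a b] [[/= Fa Ga] [Ub Vb]]; split; [exact: sW|exact: sW'].
Qed.

Lemma bar_exteriorS W W' :
  bar_exterior W -> open W' -> W `<=` W' -> bar_exterior W'.
Proof.
move=> [oW eW] oW' sW; split=> // y; have [F [U [eF oU Uy sFU]]] := eW y.
by exists F, U; split=> //; exact: subset_trans sW.
Qed.

Lemma bar_compactly_generated : compactly_generated (X * T)%type.
Proof.
apply: compactly_generated_prod; first exact: ext_compactly_generated.
  exact: ch_compact.
exact: ch_hausdorff.
Qed.

Lemma bar_weakly_hausdorff : weakly_hausdorff (X * T)%type.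
Proof.
apply: (weakly_hausdorff_prod bar_compactly_generated).
  exact: ext_weakly_hausdorff.
exact/hausdorff_weakly_hausdorff/ch_hausdorff.
Qed.

Definition bar_prod : extSpace :=
  ExtSpace bar_exterior_nonempty bar_exterior_open bar_exteriorI bar_exteriorS
    bar_compactly_generated bar_weakly_hausdorff.

Lemma bar_fst_exterior F : exterior F -> bar_exterior (fst @^-1` F).
Proof.
move=> eF; split=> [|y].
  apply: continuous_pre_open; first exact: fst_continuous.
  exact: exterior_open.
by exists F, setT; split=> //; [exact: openT|case=> ? ? []].
Qed.

Definition bar_fst : extMap bar_prod X :=
  @ExtMap bar_prod X fst (@fst_continuous _ _) bar_fst_exterior.

End BarProduct.

Section BarMap.
Variables (X Y : extSpace) (S T : compHausdorff).
Variables (f : extMap X Y) (g : S -> T).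
Hypothesis cg : continuous g.

Definition bar_map_fun (p : bar_prod X S) : bar_prod Y T := (f p.1, g p.2).

Lemma bar_map_continuous : continuous bar_map_fun.
Proof.
apply: pair_continuous.
  exact: continuousC (@fst_continuous _ _) (@ext_fun_continuous _ _ f).
exact: continuousC (@snd_continuous _ _) cg.
Qed.

Lemma bar_map_exterior W : exterior W -> exterior (bar_map_fun @^-1` W).
Proof.
move=> [oW eW]; split=> [|y].
  by apply: continuous_pre_open => //; exact: bar_map_continuous.
have [F [U [eF oU Uy sW]]] := eW (g y).
exists (f @^-1` F), (g @^-1` U); split=> //.
- exact: ext_fun_exterior.
- exact: continuous_pre_open.
- by move=> [a b] [/= Fa Ub]; exact: sW.
Qed.

Definition bar_map : extMap (bar_prod X S) (bar_prod Y T) :=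
  ExtMap bar_map_continuous bar_map_exterior.

End BarMap.

Definition is_pushout (A B C P : extSpace)
    (f : extMap A B) (g : extMap A C) (i : extMap B P) (j : extMap C P) : Prop :=
  i \o f =1 j \o g /\
  forall (Z : extSpace) (b : extMap B Z) (c : extMap C Z), b \o f =1 c \o g ->
    exists h : extMap P Z, [/\ h \o i =1 b, h \o j =1 c &
      forall h' : extMap P Z, h' \o i =1 b -> h' \o j =1 c -> h' =1 h].

(* The pushout of compactly generated weakly Hausdorff spaces: the quotient of
   the disjoint union identifying two points exactly when no cocone under
   [B <- A -> C] with vertex in E tells them apart. *)
Section Pushout.
Local Open Scope quotient_scope.
Variables (A B C : extSpace) (f : extMap A B) (g : extMap A C).

Definition copair (Z : Type) (b : B -> Z) (c : C -> Z) (p : B + C) : Z :=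
  match p with inl x => b x | inr y => c y end.

Definition po_relP (p q : B + C) : Prop :=
  forall (Z : extSpace) (b : extMap B Z) (c : extMap C Z), b \o f =1 c \o g ->
    copair b c p = copair b c q.

Definition po_rel (p q : B + C) : bool := `[< po_relP p q >].

Lemma po_rel_refl : reflexive po_rel.
Proof. by move=> p; apply/asboolP. Qed.

Lemma po_rel_sym : symmetric po_rel.
Proof.
by move=> p q; apply/asboolP/asboolP => pq Z b c bc; rewrite pq.
Qed.

Lemma po_rel_trans : transitive po_rel.
Proof.
move=> q p r /asboolP pq /asboolP qr; apply/asboolP => Z b c bc.
by rewrite pq// qr.
Qed.

Definition po_equiv := EquivRel po_rel po_rel_refl po_rel_sym po_rel_trans.

Definition po_type : Type := {eq_quot po_equiv}.

HB.instance Definition _ := Choice.on po_type.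

Definition po_pi (p : B + C) : po_type := \pi_({eq_quot po_equiv}) p.
Definition po_repr (p : po_type) : B + C := repr (p : {eq_quot po_equiv}).

Lemma po_reprK : cancel po_repr po_pi.
Proof. by move=> p; exact: reprK. Qed.

Lemma po_piP (p q : B + C) : po_pi p = po_pi q <-> po_relP p q.
Proof. by split=> [/eqmodP/asboolP|pq] //; apply/eqmodP/asboolP. Qed.

Definition po_inl_fun (x : B) : po_type := po_pi (inl x).
Definition po_inr_fun (y : C) : po_type := po_pi (inr y).

Definition po_op : set (set po_type) :=
  [set W | open (po_inl_fun @^-1` W) /\ open (po_inr_fun @^-1` W)].

Lemma po_opT : po_op setT.
Proof. by split; rewrite preimage_setT; exact: openT. Qed.

Lemma po_opI : setI_closed po_op.
Proof. by move=> V W [V1 V2] [W1 W2]; split; exact: openI. Qed.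

Lemma po_op_bigU (I : Type) (F : I -> set po_type) :
  (forall i, po_op (F i)) -> po_op (\bigcup_i F i).
Proof.
by move=> oF; split; rewrite preimage_bigcup; apply: bigcup_open => i _;
  case: (oF i).
Qed.

HB.instance Definition _ :=
  isOpenTopological.Build po_type po_opT po_opI po_op_bigU.

Lemma po_inl_continuous : continuous po_inl_fun.
Proof. by apply/continuousP => W []. Qed.

Lemma po_inr_continuous : continuous po_inr_fun.
Proof. by apply/continuousP => W []. Qed.

Section Rec.
Variables (Z : extSpace) (b : extMap B Z) (c : extMap C Z).
Hypothesis bc : b \o f =1 c \o g.

Definition po_rec_fun (p : po_type) : Z := copair b c (po_repr p).

Lemma po_rec_pi p : po_rec_fun (po_pi p) = copair b c p.
Proof.
have /po_piP : po_pi (po_repr (po_pi p)) = po_pi p by exact: po_reprK.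
exact.
Qed.

Lemma po_rec_inl x : po_rec_fun (po_inl_fun x) = b x.
Proof. exact: po_rec_pi. Qed.

Lemma po_rec_inr y : po_rec_fun (po_inr_fun y) = c y.
Proof. exact: po_rec_pi. Qed.

Lemma po_rec_preimage W :
  po_inl_fun @^-1` (po_rec_fun @^-1` W) = b @^-1` W /\
  po_inr_fun @^-1` (po_rec_fun @^-1` W) = c @^-1` W.
Proof.
by split; apply/seteqP; split=> x /=; rewrite ?po_rec_inl ?po_rec_inr.
Qed.

Lemma po_rec_continuous : continuous po_rec_fun.
Proof.
apply/continuousP => W oW; have [e1 e2] := po_rec_preimage W.
by split; rewrite ?e1 ?e2; apply: continuous_pre_open oW;
  exact: ext_fun_continuous.
Qed.

End Rec.

Definition po_exterior : set (set po_type) :=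
  [set W | [/\ open W, exterior (po_inl_fun @^-1` W) &
                       exterior (po_inr_fun @^-1` W)]].

Lemma po_exterior_nonempty : exists W, po_exterior W.
Proof.
by exists setT; split; [exact: openT|exact: exteriorT|exact: exteriorT].
Qed.

Lemma po_exterior_open W : po_exterior W -> open W.
Proof. by case. Qed.

Lemma po_exteriorI V W : po_exterior V -> po_exterior W -> po_exterior (V `&` W).
Proof.
move=> [oV V1 V2] [oW W1 W2].
by split; [exact: openI|exact: exteriorI|exact: exteriorI].
Qed.

Lemma po_exteriorS V W :
  po_exterior V -> open W -> V `<=` W -> po_exterior W.
Proof.
move=> [oV V1 V2] oW sVW; split=> //.
- apply: exteriorS V1 _ _; last by move=> x; exact: sVW.
  exact: continuous_pre_open po_inl_continuous oW.
- apply: exteriorS V2 _ _; last by move=> x; exact: sVW.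
  exact: continuous_pre_open po_inr_continuous oW.
Qed.

Lemma po_compactly_generated : compactly_generated po_type.
Proof.
move=> W cW; rewrite -openC; split; rewrite preimage_setC; apply: closed_openC;
  apply: ext_compactly_generated => K u cK hK cu.
- exact: cW (continuousC cu po_inl_continuous).
- exact: cW (continuousC cu po_inr_continuous).
Qed.

Lemma po_weakly_hausdorff : weakly_hausdorff po_type.
Proof.
apply: closed_equalizers_weakly_hausdorff; first exact: po_compactly_generated.
move=> K u v cK hK cu cv; rewrite -openC openE => k /= uvk.
have [Z [b [c [bc bck]]]] : exists (Z : extSpace) (b : extMap B Z)
    (c : extMap C Z), b \o f =1 c \o g /\
    po_rec_fun b c (u k) <> po_rec_fun b c (v k).
  apply: contrapT => nZ; apply: uvk; rewrite -[LHS]po_reprK -[RHS]po_reprK.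
  apply/po_piP => Z b c bc; apply: contrapT => ne; apply: nZ.
  by exists Z, b, c.
have cl : closed [set l | (po_rec_fun b c \o u) l = (po_rec_fun b c \o v) l].
  apply: (weakly_hausdorff_closed_equalizers (@ext_weakly_hausdorff Z)) => //.
    exact: continuousC cu (po_rec_continuous bc).
  exact: continuousC cv (po_rec_continuous bc).
apply: filterS (open_nbhs_nbhs (conj (closed_openC cl) bck)) => l /= ne uvl.
by apply: ne; rewrite uvl.
Qed.

Definition pushout : extSpace :=
  ExtSpace po_exterior_nonempty po_exterior_open po_exteriorI po_exteriorS
    po_compactly_generated po_weakly_hausdorff.

Lemma po_inl_exterior W : po_exterior W -> exterior (po_inl_fun @^-1` W).
Proof. by case. Qed.

Lemma po_inr_exterior W : po_exterior W -> exterior (po_inr_fun @^-1` W).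
Proof. by case. Qed.

Definition po_inl : extMap B pushout :=
  @ExtMap B pushout po_inl_fun po_inl_continuous po_inl_exterior.

Definition po_inr : extMap C pushout :=
  @ExtMap C pushout po_inr_fun po_inr_continuous po_inr_exterior.

Lemma po_rec_exterior (Z : extSpace) (b : extMap B Z) (c : extMap C Z)
  (bc : b \o f =1 c \o g) W :
  exterior W -> po_exterior (po_rec_fun b c @^-1` W).
Proof.
move=> eW; have [e1 e2] := po_rec_preimage bc W; split.
- apply: continuous_pre_open (po_rec_continuous bc) _.
  exact: exterior_open.
- by rewrite e1; exact: ext_fun_exterior.
- by rewrite e2; exact: ext_fun_exterior.
Qed.

Definition po_rec (Z : extSpace) (b : extMap B Z) (c : extMap C Z)
    (bc : b \o f =1 c \o g) : extMap pushout Z :=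
  @ExtMap pushout Z (po_rec_fun b c) (po_rec_continuous bc) (po_rec_exterior bc).

Lemma pushoutP : is_pushout f g po_inl po_inr.
Proof.
split=> [a|Z b c bc]; first by apply/po_piP => Z b c bc; exact: bc.
exists (po_rec bc); split=> [x|y|h hb hc p].
- exact: po_rec_inl.
- exact: po_rec_inr.
- rewrite -[p]po_reprK; case: (po_repr p) => z.
    by rewrite [RHS]po_rec_inl//; exact: hb.
  by rewrite [RHS]po_rec_inr//; exact: hc.
Qed.

End Pushout.

Section Discs.
Variables (R : realType) (n : nat).

Definition sqnorm (x : 'rV[R]_n) : R := \sum_i x ord0 i ^+ 2.

(* Mind the shift: [sphere_set R n] is S^(n-1), so it is empty for n = 0. *)
Definition sphere_set : set 'rV[R]_n := [set x | sqnorm x = 1].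
Definition disc_set : set 'rV[R]_n := [set x | sqnorm x <= 1].

Lemma sqnorm_continuous : continuous sqnorm.
Proof.
move=> x; apply: (@cvg_big _ _ _ _ _ _ _ (nbhs x) _ _ (fun i => x ord0 i ^+ 2)).
  exact: add_continuous.
move=> i _; rewrite expr2.
under eq_fun do rewrite expr2.
by apply: cvgM; exact: coord_continuous.
Qed.

Lemma disc_compact : compact disc_set.
Proof.
have cD : closed disc_set.
  exact: continuous_pre_closed sqnorm_continuous (@closed_le _ 1).
have cC : compact [set v : 'rV[R]_n | forall i, v ord0 i \in `[-1, 1]].
  exact: (@rV_compact R n (fun=> `[-1, 1]%classic)
                      (fun=> @segment_compact _ _ _)).
apply: (subclosed_compact cD cC).
move=> x /= x1 i; rewrite in_itv/= -ler_norml.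
rewrite -(@ler_pXn2r _ 2)// ?nnegrE// expr1n real_normK ?num_real//.
apply: le_trans x1; rewrite /sqnorm (bigD1 i)//= lerDl.
by apply: sumr_ge0 => j _; exact: sqr_ge0.
Qed.

Lemma sphere_sub_disc : sphere_set `<=` disc_set.
Proof. by move=> x; rewrite /disc_set/= => ->. Qed.

Lemma sphere_compact : compact sphere_set.
Proof.
apply: (subclosed_compact _ disc_compact sphere_sub_disc).
exact: continuous_pre_closed sqnorm_continuous (@closed_eq _ 1).
Qed.

Definition sphere : compHausdorff :=
  CompHausdorff (compact_set_type sphere_compact)
    (hausdorff_set_type (@norm_hausdorff _ 'rV[R]_n)).

Definition disc : compHausdorff :=
  CompHausdorff (compact_set_type disc_compact)
    (hausdorff_set_type (@norm_hausdorff _ 'rV[R]_n)).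

Definition sphere_to_disc (x : sphere) : disc :=
  exist _ (set_val x) (mem_set (sphere_sub_disc (set_valP x))).

Lemma sphere_to_disc_continuous : continuous sphere_to_disc.
Proof. by apply: to_set_type_continuous; exact: set_val_continuous. Qed.

End Discs.

Section UnitInterval.
Variable R : realType.

Definition unit_itv : set R := `[0, 1]%classic.

Definition I01 : compHausdorff :=
  CompHausdorff (compact_set_type (@segment_compact R 0 1))
    (hausdorff_set_type (@Rhausdorff R)).

Lemma unit_itv0 : unit_itv 0.
Proof. by rewrite /unit_itv/= in_itv/= lexx ler01. Qed.

Lemma unit_itv1 : unit_itv 1.
Proof. by rewrite /unit_itv/= in_itv/= lexx ler01. Qed.

Definition I0 : I01 := exist _ 0 (mem_set unit_itv0).
Definition I1 : I01 := exist _ 1 (mem_set unit_itv1).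

End UnitInterval.

Section Model.
Variable R : realType.

Definition disc_to_cyl n (x : disc R n) : ch_prod (disc R n) (I01 R) := (x, I0 R).

Lemma disc_to_cyl_continuous n : continuous (@disc_to_cyl n).
Proof.
apply: (@pair_continuous _ _ _ id (fun=> I0 R)); first exact: id_continuous.
exact: cst_continuous.
Qed.

Definition gen_cof n :
  extMap (bar_prod ext_nat (sphere R n)) (bar_prod ext_nat (disc R n)) :=
  bar_map (ext_id ext_nat) (@sphere_to_disc_continuous R n).

Definition gen_triv_cof n :
  extMap (bar_prod ext_nat (disc R n))
         (bar_prod ext_nat (ch_prod (disc R n) (I01 R))) :=
  bar_map (ext_id ext_nat) (@disc_to_cyl_continuous n).

End Model.

Definition lifts (A B X Y : extSpace) (i : extMap A B) (p : extMap X Y) : Prop :=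
  forall (a : extMap A X) (b : extMap B Y), p \o a =1 b \o i ->
    exists h : extMap B X, h \o i =1 a /\ p \o h =1 b.

Definition fibration (R : realType) (X Y : extSpace) (p : extMap X Y) : Prop :=
  forall n, lifts (gen_triv_cof R n) p.

(* The cofibrantly generated structure: trivial fibrations have the right
   lifting property against the generating cofibrations, and cofibrations the
   left lifting property against trivial fibrations. The weak equivalences
   need not be mentioned to define cofibrations and fibrations. *)
Definition trivial_fibration (R : realType) (X Y : extSpace) (p : extMap X Y) : Prop :=
  forall n, lifts (gen_cof R n) p.

Definition cofibration (R : realType) (A B : extSpace) (i : extMap A B) : Prop :=
  forall (X Y : extSpace) (p : extMap X Y), trivial_fibration R p -> lifts i p.

Section Pointed.
Variable R : realType.

Record extStar := ExtStar {
  star_space :> extSpace;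
  sec : extMap (Rplus R) star_space;
  ret : extMap star_space (Rplus R);
  ret_sec : ret \o sec =1 id }.

Record underMap (X Y : extStar) := UnderMap {
  under_map :> extMap X Y;
  under_sec : under_map \o sec X =1 sec Y }.

Record starMap (X Y : extStar) := StarMap {
  star_under :> underMap X Y;
  star_ret : ret Y \o star_under =1 ret X }.

(* E_* has zero object R_+, so that being cofibrant is a condition on [sec] and
   being fibrant one on [ret]. *)
Definition star_zero : extStar :=
  @ExtStar (Rplus R) (ext_id _) (ext_id _) (fun _ => erefl).

Definition from_zero (X : extStar) : starMap star_zero X :=
  @StarMap star_zero X (@UnderMap star_zero X (sec X) (fun _ => erefl))
    (@ret_sec X).

Definition to_zero (X : extStar) : starMap X star_zero :=
  @StarMap X star_zero (@UnderMap X star_zero (ret X) (@ret_sec X))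
    (fun _ => erefl).

Definition star_cofibration (X Y : extStar) (f : starMap X Y) : Prop :=
  cofibration R f.

Definition star_fibration (X Y : extStar) (f : starMap X Y) : Prop :=
  fibration R f.

Definition cofibrant (X : extStar) : Prop := star_cofibration (from_zero X).

Definition fibrant (Y : extStar) : Prop := star_fibration (to_zero Y).

(* [T] stands for the realization |K| of a finite simplicial set. *)
Section Tensor.
Variables (X : extStar) (T : compHausdorff).

Definition tensor_sxid : extMap (bar_prod (Rplus R) T) (bar_prod X T) :=
  bar_map (sec X) (@id_continuous T).

Definition tensor_proj : extMap (bar_prod (Rplus R) T) (Rplus R) :=
  bar_fst (Rplus R) T.

Definition tensor_space : extSpace := pushout tensor_sxid tensor_proj.

Definition tensor_in : extMap (bar_prod X T) tensor_space :=
  po_inl tensor_sxid tensor_proj.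

Definition tensor_sec : extMap (Rplus R) tensor_space :=
  po_inr tensor_sxid tensor_proj.

Lemma tensor_ret_compat :
  ext_comp (bar_fst X T) (ret X) \o tensor_sxid =1 ext_id _ \o tensor_proj.
Proof. by move=> [x t]; exact: ret_sec. Qed.

Definition tensor_ret : extMap tensor_space (Rplus R) :=
  po_rec tensor_ret_compat.

Lemma tensor_ret_sec : tensor_ret \o tensor_sec =1 id.
Proof. by move=> x; exact: (po_rec_inr tensor_ret_compat). Qed.

Definition tensor : extStar := ExtStar tensor_ret_sec.

End Tensor.

(* |Delta[1]| is the unit interval *)
Definition cylinder (X : extStar) : extStar := tensor X (I01 R).

Definition cyl_in (X : extStar) (x : X) (t : I01 R) : cylinder X :=
  tensor_in X (I01 R) (x, t).

Definition star_homotopic (X Y : extStar) (f g : starMap X Y) : Prop :=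
  exists h : starMap (cylinder X) Y,
    forall x : X, h (cyl_in x (I0 R)) = f x /\ h (cyl_in x (I1 R)) = g x.

Definition under_homotopic (X Y : extStar) (f g : underMap X Y) : Prop :=
  exists H : extMap (bar_prod X (I01 R)) Y,
    [/\ forall x : X, H (x, I0 R) = f x,
        forall x : X, H (x, I1 R) = g x &
        forall (t : I01 R) (u : Rplus R), H (sec X u, t) = sec Y u].

End Pointed.

(* The quotient of [T] by [e], used for the homotopy relations, which are
   equivalence relations. *)
Definition classes (T : Type) (e : T -> T -> Prop) : Type :=
  range (fun x : T => [set y | e x y]).

Definition class_of (T : Type) (e : T -> T -> Prop) (x : T) : classes e :=
  exist _ [set y | e x y] (mem_set (imageT (fun x => [set y | e x y]) x)).

Definition star_classes (R : realType) (X Y : extStar R) : Type :=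
  classes (@star_homotopic R X Y).

Definition under_classes (R : realType) (X Y : extStar R) : Type :=
  classes (@under_homotopic R X Y).

Definition star_class (R : realType) (X Y : extStar R) (f : starMap X Y) :
  star_classes X Y := class_of (@star_homotopic R X Y) f.

Definition under_class (R : realType) (X Y : extStar R) (f : underMap X Y) :
  under_classes X Y := class_of (@under_homotopic R X Y) f.

(* Main.v *)
Require Import Defs.
From HB Require Import structures.
From mathcomp Require Import all_boot all_order all_algebra.
From mathcomp Require Import all_classical all_reals.
From mathcomp Require Import topology normedtype realfun.
From mathcomp Require Import lra.

(** The half-line is convex, and convexly combining two exterior maps into it
    gives an exterior homotopy between them which is constant wherever they
    agree (section [Linear]). Hence, for a map g : X -> Y that respects only
    the sections, ret Y o g is homotopic to ret X relative to the section, and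
    as ret Y is a fibration one can try to lift this homotopy to Y, starting at
    g and staying equal to sec Y on the half-line; the end of the lift is a
    morphism over the half-line. In the same way, a homotopy between two
    morphisms f and f' that respects only the sections can be pushed, through a
    square of maps, to one that lies over the half-line. Three sides of this
    square lie over the half-line, and following them yields a homotopy from f
    to f' in the pointed category. So the two homotopy relations agree on
    morphisms, and every map under the half-line is homotopic to a morphism.

    Both liftings are instances of [relative_homotopy_lifting]: for a
    cofibration A -> X and a fibration Y -> Z, a homotopy into Z lifts with
    prescribed start and prescribed restriction to A. (A further interval of
    parameters is carried along, because the second argument lifts a homotopy
    of homotopies.) Cofibrations are given only by their lifting property
    against trivial fibrations, so one constructs the space E of pairs of a
    point x of X and a solution of the lifting problem at x, observes that the
    data over A is a lift of A -> X to E, and that a section of E -> X extending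
    it is precisely the desired lift. What remains is that E -> X is a trivial
    fibration ([path_proj_trivial_fibration]).

    This rests on two points. First, E must live in the category of exterior
    spaces. It gets the finest topology for which families of solutions
    parametrized by compact Hausdorff spaces are continuous; it is then
    compactly generated by construction, evaluation is continuous by the tube
    lemma, and exterior maps into E are the expected ones ([curry_path]).
    Second, unravelling the definition of E, one has to extend along
    D^n x {0} u S^(n-1) x I -> D^n x I, times an interval of parameters, for a
    sequence of discs at once and over a given map to Z. The radial flow of
    [flow] presents this inclusion as a retract of B x {0} -> B x I with
    B = D^n x I x I, and B is a retract of a disc ([retract_disc_square]), so the
    defining lifting property of fibrations applies. *)

Set Implicit Arguments.
Unset Strict Implicit.
Unset Printing Implicit Defensive.

Import Order.TTheory GRing.Theory Num.Theory.
Import numFieldNormedType.Exports.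

Local Open Scope classical_set_scope.
Local Open Scope ring_scope.

(** * Exterior maps and products with compact spaces *)

Lemma continuous_pasting (S T : topologicalType) (A B : set S) (f : S -> T) :
  closed A -> closed B -> A `|` B = setT ->
  continuous (f \o (set_val : A -> S)) -> continuous (f \o (set_val : B -> S)) ->
  continuous f.
Proof.
move=> cA cB AB fA fB; apply/continuous_subspace_setT; rewrite -AB.
by apply: withinU_continuous => //; apply/subspace_sigL_continuousP.
Qed.

(** The exterior sets containing a given one form a filter base, so that this is
    the tube lemma with a neighbourhood of infinity in place of a neighbourhood
    of a point. It reduces every exteriority statement about X x T below to one
    about X. *)
Lemma compact_bar_exterior (X : extSpace) (T : compHausdorff)
    (W : set (X * T)) : bar_exterior W ->
  exists2 F : set X, exterior F & forall x t, F x -> W (x, t).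
Proof.
move=> [oW eW].
pose E : set_system X := [set A | exists2 F : set X, exterior F & F `<=` A].
have EF : Filter E.
  split; first by exists setT; [exact: exteriorT|].
  - move=> A B [F eF sA] [G eG sB]; exists (F `&` G); first exact: exteriorI.
    by move=> x [Fx Gx]; split; [exact: sA|exact: sB].
  - by move=> A B AB [F eF sA]; exists F => //; exact: subset_trans AB.
have := @ch_compact T; rewrite compact_near_coveringP.
move=> /(_ X E (fun x t => W (x, t)) EF)[t _|F eF sF].
  have [F [U [eF oU Ut s]]] := eW t; exists (U, F) => /=.
    by split; [exact: open_nbhs_nbhs|exists F].
  by move=> [t' x] /= [Ut' Fx]; exact: s.
by exists F => // x t Fx; exact: sF.
Qed.

Section ExtMapBuild.
Variables X Y : extSpace.

Lemma exterior_of_sub (f : X -> Y) : continuous f ->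
  (forall F, exterior F -> exists2 G, exterior G & G `<=` f @^-1` F) ->
  forall F, exterior F -> exterior (f @^-1` F).
Proof.
move=> cf ef F eF; have [G eG sG] := ef F eF.
by apply: exteriorS eG _ sG; apply: continuous_pre_open cf _; exact: exterior_open.
Qed.

Definition mk_ext (f : X -> Y) (cf : continuous f)
  (ef : forall F, exterior F -> exists2 G, exterior G & G `<=` f @^-1` F) :
  extMap X Y := ExtMap cf (exterior_of_sub cf ef).

End ExtMapBuild.

Section BarSlice.
Variables (X : extSpace) (T : compHausdorff) (t : T).

Lemma bar_slice_continuous : continuous (fun x : X => (x, t) : bar_prod X T).
Proof. by apply: pair_continuous; [exact: id_continuous|exact: cst_continuous]. Qed.

Lemma bar_slice_exterior F : exterior F -> exists2 G, exterior G &
  G `<=` (fun x : X => (x, t) : bar_prod X T) @^-1` F.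
Proof.
move=> eF; have [G eG sG] := compact_bar_exterior eF.
by exists G => // x Gx; exact: sG.
Qed.

Definition bar_slice : extMap X (bar_prod X T) :=
  mk_ext bar_slice_continuous bar_slice_exterior.

End BarSlice.

Lemma prod_assoc_continuous (A B C : topologicalType) :
  continuous (fun p : A * (B * C) => ((p.1, p.2.1), p.2.2)).
Proof.
apply: pair_continuous; first apply: pair_continuous.
- exact: fst_continuous.
- exact: continuousC (@snd_continuous _ _) (@fst_continuous _ _).
- exact: continuousC (@snd_continuous _ _) (@snd_continuous _ _).
Qed.

Lemma prod_assocV_continuous (A B C : topologicalType) :
  continuous (fun p : (A * B) * C => (p.1.1, (p.1.2, p.2))).
Proof.
apply: pair_continuous; last apply: pair_continuous.
- exact: continuousC (@fst_continuous _ _) (@fst_continuous _ _).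
- exact: continuousC (@fst_continuous _ _) (@snd_continuous _ _).
- exact: snd_continuous.
Qed.

Section BarReassociation.
Variables (X : extSpace) (S T : compHausdorff).

Definition bar_assoc_fun (p : bar_prod X (ch_prod S T)) :
  bar_prod (bar_prod X S) T := ((p.1, p.2.1), p.2.2).

Lemma bar_assoc_exterior F : exterior F ->
  exists2 G, exterior G & G `<=` bar_assoc_fun @^-1` F.
Proof.
move=> /compact_bar_exterior[F1 eF1 sF1].
have [F2 eF2 sF2] := compact_bar_exterior eF1.
exists (fst @^-1` F2); first exact: bar_fst_exterior.
by move=> [x [s t]] /= F2x; apply/sF1/sF2.
Qed.

Definition bar_assoc :=
  mk_ext (@prod_assoc_continuous X S T : continuous bar_assoc_fun)
    bar_assoc_exterior.

Definition bar_assocV_fun (p : bar_prod (bar_prod X S) T) :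
  bar_prod X (ch_prod S T) := (p.1.1, (p.1.2, p.2)).

Lemma bar_assocV_exterior F : exterior F ->
  exists2 G, exterior G & G `<=` bar_assocV_fun @^-1` F.
Proof.
move=> /compact_bar_exterior[F1 eF1 sF1].
exists (fst @^-1` (fst @^-1` F1)).
  by apply: bar_fst_exterior; exact: bar_fst_exterior.
by move=> [[x s] t] /= F1x; exact: sF1.
Qed.

Definition bar_assocV :=
  mk_ext (@prod_assocV_continuous X S T : continuous bar_assocV_fun)
    bar_assocV_exterior.

End BarReassociation.

(** * Spaces of maps out of a compact space, fibred over a base *)

Section PathSpace.
Variables (X Y : extSpace) (T : compHausdorff) (P : X -> (T -> Y) -> Prop).

(** The predicate [P] cuts out the pairs of interest, for instance the solutions
    of a lifting problem. The topology below is adapted to this subset itself,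
    rather than restricted from the space of all pairs, which would not keep it
    compactly generated. *)
Definition path_set : set (X * (T -> Y)) :=
  [set p | continuous p.2 /\ P p.1 p.2].

Definition path_type : Type := path_set.

HB.instance Definition _ := Choice.on path_type.

Definition path_base (e : path_type) : X := (set_val e).1.
Definition path_ev (e : path_type) : T -> Y := (set_val e).2.

Lemma path_ev_continuous_r e : continuous (path_ev e).
Proof. by have [] := set_valP e. Qed.

Lemma path_spaceP e : P (path_base e) (path_ev e).
Proof. by have [] := set_valP e. Qed.

(** The maps from compact Hausdorff spaces that ought to be continuous; the
    topology is the finest one making them so. *)
Definition plot (K : topologicalType) (u : K -> path_type) : Prop :=
  continuous (path_base \o u) /\
  continuous (fun p : K * T => path_ev (u p.1) p.2).

Definition path_op : set (set path_type) :=
  [set W | forall (K : topologicalType) (u : K -> path_type),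
     compact [set: K] -> hausdorff_space K -> plot u -> open (u @^-1` W)].

Lemma path_opT : path_op setT.
Proof. by move=> K u _ _ _; rewrite preimage_setT; exact: openT. Qed.

Lemma path_opI : setI_closed path_op.
Proof. by move=> V W oV oW K u cK hK pu; apply: openI; [exact: oV|exact: oW]. Qed.

Lemma path_op_bigU (I : Type) (F : I -> set path_type) :
  (forall i, path_op (F i)) -> path_op (\bigcup_i F i).
Proof.
move=> oF K u cK hK pu; rewrite preimage_bigcup.
by apply: bigcup_open => i _; exact: oF.
Qed.

HB.instance Definition _ :=
  isOpenTopological.Build path_type path_opT path_opI path_op_bigU.

Lemma path_openP (W : set path_type) : open W <->
  forall (K : topologicalType) (u : K -> path_type),
    compact [set: K] -> hausdorff_space K -> plot u -> open (u @^-1` W).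
Proof. by []. Qed.

Lemma plot_continuous (K : topologicalType) (u : K -> path_type) :
  compact [set: K] -> hausdorff_space K -> plot u -> continuous u.
Proof. by move=> cK hK pu; apply/continuousP => W /path_openP; exact. Qed.

Lemma path_base_continuous : continuous path_base.
Proof.
apply/continuousP => W oW; apply/path_openP => K u cK hK [cu _].
by rewrite -comp_preimage; exact: continuous_pre_open.
Qed.

(** Sets of compact-open type are open, since a plot pulls them back to sets
    handled by the tube lemma. *)
Lemma open_path_within (C : set T) (V : set Y) : compact C -> open V ->
  open [set e : path_type | forall t : C, V (path_ev e (set_val t))].
Proof.
move=> cC oV; apply/path_openP => K u cK hK [_ cu].
apply: (@open_tube K C ((fun p => path_ev (u p.1) (set_val p.2)) @^-1` V)).
  exact: compact_set_type.
apply: continuous_pre_open oV.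
apply: (@continuousC _ _ _ (fun p : K * C => (p.1, set_val p.2))
  (fun p : K * T => path_ev (u p.1) p.2)) cu.
apply: pair_continuous; first exact: fst_continuous.
exact: continuousC (@snd_continuous _ _) (@set_val_continuous _ _).
Qed.

(** As T is regular, a map sending t0 into V sends a compact neighbourhood of
    t0 into V, and maps with the latter property form an open set. *)
Lemma path_ev_continuous :
  continuous (fun p : path_type * T => path_ev p.1 p.2).
Proof.
apply/continuousP => V oV; rewrite openE => -[e0 t0] V0.
have nV : nbhs t0 (path_ev e0 @^-1` V).
  apply: open_nbhs_nbhs; split=> //.
  by apply: continuous_pre_open oV; exact: path_ev_continuous_r.
have [C nC sC] :=
  @compact_regular T t0 setT (@ch_hausdorff T) (@ch_compact T) filterT _ nV.
exists ([set e | forall t : closure C, V (path_ev e (set_val t))], C).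
  split=> //=; apply: open_nbhs_nbhs; split.
    apply: open_path_within => //.
    apply: (subclosed_compact _ (@ch_compact T)) => //; exact: closed_closure.
  by move=> t; apply: sC; exact: set_valP.
move=> [e t] /= [Ve Ct].
by have := Ve (exist _ t (mem_set (subset_closure Ct))).
Qed.

Lemma path_compactly_generated : compactly_generated path_type.
Proof.
move=> A cA; rewrite -openC; apply/path_openP => K u cK hK pu; rewrite preimage_setC.
by apply: closed_openC; apply: cA => //; exact: plot_continuous.
Qed.

Lemma path_ext (e e' : path_type) :
  path_base e = path_base e' -> path_ev e =1 path_ev e' -> e = e'.
Proof.
move=> eb /funext ee; apply: val_inj; rewrite -!set_valE.
by rewrite (surjective_pairing (set_val e)) (surjective_pairing (set_val e'));
  congr pair.
Qed.

(** Base point and evaluations are continuous and jointly injective, so that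
    equalizers are intersections of closed equalizers. *)
Lemma path_weakly_hausdorff : weakly_hausdorff path_type.
Proof.
apply: closed_equalizers_weakly_hausdorff; first exact: path_compactly_generated.
move=> K u v cK hK cu cv.
rewrite (_ : mkset _ = [set k | (path_base \o u) k = (path_base \o v) k] `&`
    \bigcap_(t : T) [set k | path_ev (u k) t = path_ev (v k) t]).
  apply: closedI.
    apply: (weakly_hausdorff_closed_equalizers (@ext_weakly_hausdorff X)) => //.
      exact: continuousC cu path_base_continuous.
    exact: continuousC cv path_base_continuous.
  apply: closed_bigI => t _.
  have cev (w : K -> path_type) : continuous w ->
      continuous (fun k => path_ev (w k) t).
    move=> cw.
    apply: (@continuousC _ _ _ (fun k => (w k, t)) _ _ path_ev_continuous).
    by apply: pair_continuous => //; exact: cst_continuous.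
  apply: (weakly_hausdorff_closed_equalizers (@ext_weakly_hausdorff Y)) => //;
    exact: cev.
apply/seteqP; split=> k /=.
  by move=> uv; rewrite uv; split; last by move=> t _ /=; rewrite uv.
by move=> [eb ee]; apply: path_ext => // t; exact: ee.
Qed.

(** These sets generate the externology: T being compact, an exterior map from
    W x T to Y sends some F x T, with F exterior in W, into a given exterior
    set. *)
Definition path_box (G : set X) (F : set Y) : set path_type :=
  [set e | G (path_base e) /\ forall t, F (path_ev e t)].

Definition path_exterior : set (set path_type) :=
  [set W | open W /\ exists G F,
     [/\ exterior G, exterior F & path_box G F `<=` W]].

Lemma path_exterior_nonempty : exists W, path_exterior W.
Proof.
exists setT; split; first exact: openT.
by exists setT, setT; split=> //; exact: exteriorT.
Qed.

Lemma path_exterior_open W : path_exterior W -> open W.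
Proof. by case. Qed.

Lemma path_exteriorI V W :
  path_exterior V -> path_exterior W -> path_exterior (V `&` W).
Proof.
move=> [oV [G [F [eG eF sV]]]] [oW [G' [F' [eG' eF' sW]]]].
split; first exact: openI.
exists (G `&` G'), (F `&` F'); split; [exact: exteriorI|exact: exteriorI|].
move=> e [[Ge G'e] FF'e].
by split; [apply: sV|apply: sW]; split=> // t; have [] := FF'e t.
Qed.

Lemma path_exteriorS V W :
  path_exterior V -> open W -> V `<=` W -> path_exterior W.
Proof.
move=> [_ [G [F [eG eF sV]]]] oW sVW; split=> //; exists G, F; split=> //.
exact: subset_trans sVW.
Qed.

Definition path_space : extSpace :=
  ExtSpace path_exterior_nonempty path_exterior_open path_exteriorI
    path_exteriorS path_compactly_generated path_weakly_hausdorff.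

Lemma path_box_exterior G F : exterior G -> exterior F ->
  exterior (path_box G F : set path_space).
Proof.
move=> eG eF; split; last by exists G, F; split=> //; exact: subset_refl.
rewrite (_ : path_box G F = path_base @^-1` G `&`
    [set e | forall t : [set: T], F (path_ev e (set_val t))]).
  apply: openI.
    by apply: continuous_pre_open (exterior_open eG); exact: path_base_continuous.
  by apply: open_path_within (exterior_open eF); exact: ch_compact.
apply/seteqP; split=> e [Ge Fe]; split=> // t.
by have := Fe (exist _ t (mem_set I)).
Qed.

Lemma path_base_exterior G : exterior G ->
  exterior (path_base @^-1` G : set path_space).
Proof.
move=> eG; split.
  by apply: continuous_pre_open (exterior_open eG); exact: path_base_continuous.
by exists G, setT; split=> //; [exact: exteriorT|move=> e []].
Qed.

Definition path_proj : extMap path_space X :=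
  @ExtMap path_space X path_base path_base_continuous path_base_exterior.

(** A map into the space of paths is the same as its base component together
    with its adjoint: continuity is tested on compact Hausdorff spaces, because
    the source is compactly generated. *)
Section Curry.
Variables (W : extSpace) (f : extMap W X) (F : extMap (bar_prod W T) Y).
Hypothesis PF : forall w, P (f w) (fun t => F (w, t)).

Lemma curry_subproof w : path_set (f w, fun t => F (w, t)).
Proof.
split; last exact: PF.
apply: (@continuousC _ _ _ (fun t => (w, t)) F);
  last exact: (@ext_fun_continuous _ _ F).
by apply: pair_continuous; [exact: cst_continuous|exact: id_continuous].
Qed.

Definition curry_fun (w : W) : path_space :=
  exist (fun p => p \in path_set) _ (mem_set (curry_subproof w)).

Lemma curry_continuous : continuous curry_fun.
Proof.
apply/continuousP => V /path_openP oV.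
apply: (compactly_generated_open (@ext_compactly_generated W)) => K u cK hK cu.
apply: (oV K (curry_fun \o u) cK hK); split.
  exact: continuousC cu (@ext_fun_continuous _ _ f).
apply: (@continuousC _ _ _ (fun p : K * T => (u p.1, p.2)) F).
  apply: pair_continuous; last exact: snd_continuous.
  exact: continuousC (@fst_continuous _ _) cu.
exact: (@ext_fun_continuous _ _ F).
Qed.

Lemma curry_exterior V : exterior V -> exists2 G, exterior G &
  G `<=` curry_fun @^-1` V.
Proof.
move=> [oV [G [H [eG eH sV]]]].
have [G' eG' sG'] := compact_bar_exterior (ext_fun_exterior F eH).
exists (f @^-1` G `&` G').
  by apply: exteriorI => //; exact: ext_fun_exterior.
by move=> w [/= Gw G'w]; apply: sV; split=> // t; exact: sG'.
Qed.

Definition curry_path : extMap W path_space :=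
  mk_ext curry_continuous curry_exterior.

End Curry.

End PathSpace.

(** * The interval and the discs *)

Section RealContinuity.
Variables (R : realType) (W : topologicalType).
Implicit Types f g : W -> R.

Lemma contD f g : continuous f -> continuous g -> continuous (fun w => f w + g w).
Proof. by move=> cf cg w; apply: cvgD; [exact: cf|exact: cg]. Qed.

Lemma contB f g : continuous f -> continuous g -> continuous (fun w => f w - g w).
Proof. by move=> cf cg w; apply: cvgB; [exact: cf|exact: cg]. Qed.

Lemma contM f g : continuous f -> continuous g -> continuous (fun w => f w * g w).
Proof. by move=> cf cg w; apply: cvgM; [exact: cf|exact: cg]. Qed.

Lemma contV f : (forall w, f w != 0) -> continuous f ->
  continuous (fun w => (f w)^-1).
Proof. by move=> f0 cf w; apply: cvgV => //; exact: cf. Qed.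

Lemma cont_max f g : continuous f -> continuous g ->
  continuous (fun w => Num.max (f w) (g w)).
Proof. by move=> cf cg w; apply: continuous_max; [exact: cf|exact: cg]. Qed.

Lemma cont_min f g : continuous f -> continuous g ->
  continuous (fun w => Num.min (f w) (g w)).
Proof. by move=> cf cg w; apply: continuous_min; [exact: cf|exact: cg]. Qed.

Lemma continuous_row n (f : W -> 'rV[R]_n) :
  (forall i, continuous (fun w => f w ord0 i)) -> continuous f.
Proof.
move=> cf w A [B nB sBA].
apply: (@filterS _ (nbhs w) _ (fun w' => forall i : 'I_n, B ord0 i (f w' ord0 i))).
  by move=> w' Bw'; apply: sBA => i j; rewrite ord1; exact: Bw'.
by apply: filter_forall => i; apply: cf; exact: nB.
Qed.

End RealContinuity.

Section UnitInterval.
Variable R : realType.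
Local Notation I := (I01 R).

Lemma I01_ge0 (t : I) : 0 <= set_val t :> R.
Proof. by have := set_valP t; rewrite /unit_itv/= in_itv/= => /andP[]. Qed.

Lemma I01_le1 (t : I) : set_val t <= 1 :> R.
Proof. by have := set_valP t; rewrite /unit_itv/= in_itv/= => /andP[]. Qed.

Lemma clamp_subproof (x : R) : unit_itv (Num.max 0 (Num.min 1 x)).
Proof.
by rewrite /unit_itv/= in_itv/= le_max lexx/= ge_max ler01 ge_min lexx.
Qed.

(** With this retraction of R onto I, and [proj_disc] of R^n onto the disc, real
    formulas define maps into the subtypes without any bound to be verified
    beforehand. *)
Definition clamp (x : R) : I :=
  exist (fun y : R => y \in @unit_itv R) _ (mem_set (clamp_subproof x)).

Lemma val_clamp (x : R) : set_val (clamp x) = Num.max 0 (Num.min 1 x).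
Proof. by []. Qed.

Lemma clamp_continuous : continuous clamp.
Proof.
apply: to_set_type_continuous.
apply: (@cont_max R _ (fun=> 0) (fun x : R => Num.min 1 x)).
  exact: cst_continuous.
by apply: cont_min; [exact: cst_continuous|exact: id_continuous].
Qed.

Lemma clampK (t : I) : clamp (set_val t) = t.
Proof.
apply: val_inj; rewrite -!set_valE val_clamp.
by rewrite min_r ?I01_le1// max_r ?I01_ge0.
Qed.

Lemma clamp_le0 x : x <= 0 -> clamp x = I0 R.
Proof.
move=> x0; apply: val_inj; rewrite -!set_valE val_clamp max_l//.
by rewrite ge_min x0 orbT.
Qed.

Lemma clamp_ge1 x : 1 <= x -> clamp x = I1 R.
Proof.
move=> x1; apply: val_inj; rewrite -!set_valE val_clamp min_l//.
by rewrite max_r ?ler01.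
Qed.

Lemma contI (W : topologicalType) (f : W -> I) :
  continuous f -> continuous (fun w => set_val (f w) : R).
Proof. by move=> cf; exact: continuousC cf (@set_val_continuous _ _). Qed.

Lemma cont_clamp (W : topologicalType) (f : W -> R) :
  continuous f -> continuous (fun w => clamp (f w)).
Proof. by move=> cf; exact: continuousC cf clamp_continuous. Qed.

End UnitInterval.

Section Disc.
Variables (R : realType) (n : nat).
Local Notation D := (disc R n).

Definition norm2 (x : 'rV[R]_n) : R := Num.sqrt (sqnorm x).

Lemma norm2_continuous : continuous norm2.
Proof. exact: continuousC (@sqnorm_continuous R n) (@sqrt_continuous R). Qed.

Lemma sqnorm_ge0 (x : 'rV[R]_n) : 0 <= sqnorm x.
Proof. by apply: sumr_ge0 => i _; exact: sqr_ge0. Qed.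

Lemma sqnormZ a (x : 'rV[R]_n) : sqnorm (a *: x) = a ^+ 2 * sqnorm x.
Proof. by rewrite /sqnorm mulr_sumr; apply: eq_bigr => i _; rewrite mxE exprMn. Qed.

Lemma norm2_sqr (x : 'rV[R]_n) : norm2 x ^+ 2 = sqnorm x.
Proof. by rewrite sqr_sqrtr ?sqnorm_ge0. Qed.

Lemma norm2_ge0 (x : 'rV[R]_n) : 0 <= norm2 x.
Proof. exact: sqrtr_ge0. Qed.

Lemma norm2_le1 (x : 'rV[R]_n) : disc_set x -> norm2 x <= 1.
Proof. by move=> x1; rewrite -sqrtr1 ler_wsqrtr. Qed.

Lemma norm2_sphere (x : 'rV[R]_n) : sphere_set x -> norm2 x = 1.
Proof. by rewrite /sphere_set/= /norm2 => ->; rewrite sqrtr1. Qed.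

(** The nearest-point retraction onto the disc. *)
Definition squash (x : 'rV[R]_n) : 'rV[R]_n := (Num.max 1 (norm2 x))^-1 *: x.

Lemma max1_gt0 (a : R) : 0 < Num.max 1 a.
Proof. by rewrite lt_max ltr01. Qed.

Lemma squash_disc x : disc_set (squash x).
Proof.
rewrite /disc_set/= sqnormZ -norm2_sqr -exprMn mulrC.
rewrite -[leRHS](expr1n R 2) ler_pXn2r ?nnegrE ?ler01//.
  by rewrite ler_pdivrMr ?max1_gt0// mul1r le_max lexx orbT.
by rewrite divr_ge0 ?norm2_ge0// ltW ?max1_gt0.
Qed.

Definition proj_disc (x : 'rV[R]_n) : D :=
  exist (fun y => y \in @disc_set R n) _ (mem_set (squash_disc x)).

Lemma val_proj_disc x : set_val (proj_disc x) = squash x.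
Proof. by []. Qed.

Lemma squash_id x : disc_set x -> squash x = x.
Proof. by move=> /norm2_le1 x1; rewrite /squash max_l// invr1 scale1r. Qed.

Lemma proj_discK (x : D) : proj_disc (set_val x) = x.
Proof.
by apply: val_inj; rewrite -!set_valE val_proj_disc squash_id//; exact: set_valP.
Qed.

Lemma proj_disc_continuous : continuous proj_disc.
Proof.
apply: to_set_type_continuous => x.
apply: (@cvgZ _ _ _ (nbhs x) _ (fun x => (Num.max 1 (norm2 x))^-1) id);
  last exact: cvg_id.
apply: (@contV R _ (fun x : 'rV[R]_n => Num.max 1 (norm2 x))).
  by move=> y; rewrite gt_eqF ?max1_gt0.
apply: cont_max; [exact: cst_continuous|exact: norm2_continuous].
Qed.

Lemma cont_proj_disc (W : topologicalType) (f : W -> 'rV[R]_n) :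
  (forall i, continuous (fun w => f w ord0 i)) -> continuous (proj_disc \o f).
Proof.
by move=> cf; exact: continuousC (continuous_row cf) proj_disc_continuous.
Qed.

Lemma cont_disc_coord (W : topologicalType) (f : W -> D) i :
  continuous f -> continuous (fun w => (set_val (f w) : 'rV[R]_n) ord0 i).
Proof.
move=> cf.
exact: continuousC (continuousC cf (@set_val_continuous _ _))
  (@coord_continuous _ _ _ _ _).
Qed.

End Disc.

Definition retract_of (Q Q' : topologicalType) : Prop :=
  exists (e : Q -> Q') (r : Q' -> Q), [/\ continuous e, continuous r & cancel e r].

Lemma retract_trans (Q1 Q2 Q3 : topologicalType) :
  retract_of Q1 Q2 -> retract_of Q2 Q3 -> retract_of Q1 Q3.
Proof.
move=> [e [r [ce cr K]]] [e' [r' [ce' cr' K']]].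
exists (e' \o e), (r \o r'); split; try exact: continuousC.
exact: can_comp.
Qed.

Lemma retract_prod (Q1 Q2 T : topologicalType) :
  retract_of Q1 Q2 -> retract_of (Q1 * T)%type (Q2 * T)%type.
Proof.
move=> [e [r [ce cr K]]].
exists (fun p => (e p.1, p.2)), (fun p => (r p.1, p.2)).
split; last by move=> [x t] /=; rewrite K.
- apply: pair_continuous; last exact: snd_continuous.
  exact: continuousC (@fst_continuous _ _) ce.
- apply: pair_continuous; last exact: snd_continuous.
  exact: continuousC (@fst_continuous _ _) cr.
Qed.

Lemma retract_assoc (A B C : topologicalType) :
  retract_of (A * (B * C))%type ((A * B) * C)%type.
Proof.
exists (fun p => ((p.1, p.2.1), p.2.2)), (fun p => (p.1.1, (p.1.2, p.2))).
split; [exact: prod_assoc_continuous|exact: prod_assocV_continuous|].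
by move=> [a [b c]].
Qed.

Section DiscRetract.
Variables (R : realType) (n : nat).
Local Notation D := (disc R n).
Local Notation I := (I01 R).

(** Halving both coordinates makes the cylinder fit into the unit ball, because
    1/4 + 1/4 <= 1. *)
Definition cyl_row (p : D * I) : 'rV[R]_n.+1 :=
  \row_k (if unlift ord0 k is Some i then set_val p.1 ord0 i / 2
          else set_val p.2 / 2).

Lemma cyl_row0 p : cyl_row p ord0 ord0 = set_val p.2 / 2.
Proof. by rewrite mxE unlift_none. Qed.

Lemma cyl_rowS p i : cyl_row p ord0 (lift ord0 i) = set_val p.1 ord0 i / 2.
Proof. by rewrite mxE liftK. Qed.

Lemma cyl_row_disc p : disc_set (cyl_row p).
Proof.
rewrite /disc_set/= /sqnorm big_ord_recl cyl_row0.
under eq_bigr do rewrite cyl_rowS exprMn.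
rewrite -mulr_suml.
have x1 : \sum_(i < n) set_val p.1 ord0 i ^+ 2 <= 1 := set_valP p.1.
have := I01_ge0 p.2; have := I01_le1 p.2.
move: (set_val p.2) => t t1 t0.
have t2 : t ^+ 2 <= 1 by rewrite expr_le1.
rewrite exprMn -mulrDl exprVn.
rewrite ler_pdivrMr ?mul1r; last by rewrite exprn_gt0.
apply: le_trans (lerD t2 x1) _; lra.
Qed.

Lemma retract_disc_prod : retract_of (D * I)%type (disc R n.+1).
Proof.
exists (@proj_disc R n.+1 \o cyl_row).
pose c (y : disc R n.+1) i : R := (set_val y : 'rV[R]_n.+1) ord0 i.
exists (fun y => (proj_disc (\row_(i < n) (2 * c y (lift ord0 i)) : 'rV[R]_n),
  clamp (2 * c y ord0))); split.
- apply: cont_proj_disc => k; under eq_fun do rewrite mxE.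
  case: unlift => [i|]; apply: contM; try exact: cst_continuous.
    by apply: cont_disc_coord; exact: fst_continuous.
  by apply: contI; exact: snd_continuous.
- apply: pair_continuous; first apply: cont_proj_disc => i.
    under eq_fun do rewrite mxE.
    apply: contM; first exact: cst_continuous.
    by apply: cont_disc_coord; exact: id_continuous.
  apply: cont_clamp; apply: contM; first exact: cst_continuous.
  by apply: cont_disc_coord; exact: id_continuous.
- move=> [x t] /=; rewrite /c val_proj_disc squash_id; last exact: cyl_row_disc.
  congr pair; last by rewrite cyl_row0 mulrC divfK ?pnatr_eq0// clampK.
  rewrite -[RHS]proj_discK; congr proj_disc; apply/rowP => i.
  by rewrite mxE cyl_rowS mulrC divfK ?pnatr_eq0.
Qed.

End DiscRetract.

(** Discs suffice to test lifting against more general compact spaces: a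
    retract of a disc inherits the lifting property. *)
Lemma retract_disc_square (R : realType) n :
  retract_of (disc R n * (I01 R * I01 R))%type (disc R n.+2).
Proof.
apply: retract_trans (retract_assoc _ _ _) _.
apply: retract_trans (retract_disc_prod R n.+1).
exact/retract_prod/retract_disc_prod.
Qed.

(** * Radial flow onto the bottom and the side of a cylinder *)

Section Flow.
Variables (R : realType) (n : nat).
Local Notation D := (disc R n).
Local Notation I := (I01 R).
Local Notation T := (ch_prod I I).
Implicit Types b : D * T.

(** A point (x, (j, t)) stands for (x, t) in D^n x I with a parameter j that
    remains fixed. Projecting radially from (0, 2), the ray through (x, t)
    consists of the points (l x, 2 - l (2 - t)). It leaves the cylinder, through
    the bottom t = 0 or the side |x| = 1, at l = 1 / gauge; the gauge is 1
    exactly on the bottom and the side. *)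
Definition gauge b : R :=
  Num.max (norm2 (set_val b.1)) (1 - set_val b.2.2 / 2).

Lemma gauge_ge b : 2^-1 <= gauge b.
Proof.
rewrite le_max; apply/orP; right.
by have := I01_le1 b.2.2; lra.
Qed.

Lemma gauge_le1 b : gauge b <= 1.
Proof.
rewrite ge_max norm2_le1; last exact: set_valP.
by have := I01_ge0 b.2.2; lra.
Qed.

Lemma gauge_gt0 b : 0 < gauge b.
Proof. by apply: lt_le_trans (gauge_ge b); rewrite invr_gt0. Qed.

Lemma gaugeV_ge1 b : 1 <= (gauge b)^-1.
Proof. by rewrite -[leLHS]invr1 lef_pV2 ?posrE ?gauge_gt0// gauge_le1. Qed.

Lemma gaugeV_le2 b : (gauge b)^-1 <= 2.
Proof.
by rewrite -[leRHS]invrK lef_pV2 ?posrE ?gauge_gt0 ?gauge_ge// invr_gt0.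
Qed.

Lemma gauge_continuous : continuous gauge.
Proof.
apply: cont_max.
  apply: continuousC (@norm2_continuous R n).
  exact: continuousC (@fst_continuous _ _) (@set_val_continuous _ _).
apply: contB; first exact: cst_continuous.
apply: contM; last exact: cst_continuous.
apply: contI.
exact: continuousC (@snd_continuous _ _) (@snd_continuous _ _).
Qed.

(** [flow (b, s)] follows the ray through b from its exit point, reached at
    s = 0, back to b, reached at s = [flow_time b]. Hence a lift G along
    B x {0} -> B x I restricts, on the graph of [flow_time], to a lift that on
    the bottom and the side has the values of G at time 0. *)
Definition flow_time b : I := clamp ((gauge b)^-1 - 1).

Definition flow_factor (p : (D * T) * I) : R :=
  Num.max 1 ((gauge p.1)^-1 - set_val p.2).

Definition flow (p : (D * T) * I) : D * T :=
  (proj_disc (flow_factor p *: (set_val p.1.1)),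
   (p.1.2.1, clamp (2 - flow_factor p * (2 - set_val p.1.2.2)))).

Lemma gaugeV_continuous : continuous (fun b => (gauge b)^-1).
Proof.
apply: contV; last exact: gauge_continuous.
by move=> b; rewrite gt_eqF ?gauge_gt0.
Qed.

Lemma flow_time_continuous : continuous flow_time.
Proof.
apply: cont_clamp; apply: contB; last exact: cst_continuous.
exact: gaugeV_continuous.
Qed.

Lemma flow_factor_continuous : continuous flow_factor.
Proof.
apply: cont_max; first exact: cst_continuous.
apply: contB; first exact: continuousC (@fst_continuous _ _) gaugeV_continuous.
by apply: contI; exact: snd_continuous.
Qed.

Lemma flow_continuous : continuous flow.
Proof.
have c2 : continuous (fun p : (D * T) * I => p.1.2).
  exact: continuousC (@fst_continuous _ _) (@snd_continuous _ _).
apply: pair_continuous; last apply: pair_continuous.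
- apply: cont_proj_disc => i; under eq_fun do rewrite mxE.
  apply: contM; first exact: flow_factor_continuous.
  apply: cont_disc_coord.
  exact: continuousC (@fst_continuous _ _) (@fst_continuous _ _).
- exact: continuousC c2 (@fst_continuous _ _).
- apply: cont_clamp; apply: contB; first exact: cst_continuous.
  apply: contM; first exact: flow_factor_continuous.
  apply: contB; first exact: cst_continuous.
  by apply: contI; exact: continuousC c2 (@snd_continuous _ _).
Qed.

Lemma flow_end b : flow (b, flow_time b) = b.
Proof.
rewrite /flow; have -> : flow_factor (b, flow_time b) = 1.
  rewrite /flow_factor/= val_clamp max_l//.
  have := gaugeV_ge1 b; have := gaugeV_le2 b; move: (gauge b)^-1 => g g2 g1.
  by rewrite min_r ?max_r; lra.
rewrite scale1r proj_discK mul1r /= opprB addrCA subrr addr0 clampK.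
by case: b => [x [j t]].
Qed.

Lemma flow_factor0 b : flow_factor (b, I0 R) = (gauge b)^-1.
Proof. by rewrite /flow_factor/= subr0 max_r// gaugeV_ge1. Qed.

Lemma flow_start_bottom b : norm2 (set_val b.1) <= 1 - set_val b.2.2 / 2 ->
  (flow (b, I0 R)).2.2 = I0 R.
Proof.
move=> le; rewrite /flow/= flow_factor0; apply: clamp_le0.
have -> : 2 - set_val b.2.2 = 2 * gauge b.
  by rewrite /gauge max_r//; lra.
by rewrite mulrCA mulVf ?gt_eqF ?gauge_gt0// mulr1 subrr.
Qed.

Lemma flow_start_side b : 1 - set_val b.2.2 / 2 <= norm2 (set_val b.1) ->
  sphere_set (set_val (flow (b, I0 R)).1).
Proof.
move=> le; rewrite /flow/= flow_factor0.
have s1 : sphere_set ((gauge b)^-1 *: set_val b.1).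
  rewrite /sphere_set/= sqnormZ -norm2_sqr -exprMn.
  have gb : gauge b = norm2 (set_val b.1) by rewrite /gauge max_l.
  by rewrite -gb mulVf ?gt_eqF ?gauge_gt0// expr1n.
by rewrite val_proj_disc squash_id//; exact: sphere_sub_disc.
Qed.

Lemma flow_time_bottom b : b.2.2 = I0 R -> flow_time b = I0 R.
Proof.
move=> b0; apply: clamp_le0.
suff -> : gauge b = 1 by rewrite invr1 subrr.
apply/le_anti; rewrite gauge_le1 le_max b0 /=.
by rewrite mul0r subr0 lexx orbT.
Qed.

Lemma flow_time_side b : sphere_set (set_val b.1) -> flow_time b = I0 R.
Proof.
move=> b1; apply: clamp_le0.
suff -> : gauge b = 1 by rewrite invr1 subrr.
by apply/le_anti; rewrite gauge_le1 le_max norm2_sphere// lexx.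
Qed.

End Flow.

(** * Relative homotopy lifting *)

Section Fibration.
Variables (R : realType) (Y Z : extSpace) (p : extMap Y Z).
Hypothesis fp : fibration R p.
Local Notation I := (I01 R).

Lemma fibration_retract_lift (Q : compHausdorff) n
    (a : extMap (bar_prod ext_nat Q) Y)
    (b : extMap (bar_prod ext_nat (ch_prod Q I)) Z) :
  retract_of Q (disc R n) ->
  (forall m q, p (a (m, q)) = b (m, (q, I0 R))) ->
  exists H : extMap (bar_prod ext_nat (ch_prod Q I)) Y,
    (forall m q, H (m, (q, I0 R)) = a (m, q)) /\ p \o H =1 b.
Proof.
move=> [e [r [ce cr eK]]] ab.
have ce1 : continuous (fun q : ch_prod Q I => (e q.1, q.2) : ch_prod (disc R n) I).
  apply: pair_continuous; last exact: snd_continuous.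
  exact: continuousC (@fst_continuous _ _) ce.
have cr1 : continuous (fun q : ch_prod (disc R n) I => (r q.1, q.2) : ch_prod Q I).
  apply: pair_continuous; last exact: snd_continuous.
  exact: continuousC (@fst_continuous _ _) cr.
have [[m x]|H [Ha Hb]] := @fp n (ext_comp (bar_map (ext_id ext_nat) cr) a)
    (ext_comp (bar_map (ext_id ext_nat) cr1) b).
  exact: ab.
exists (ext_comp (bar_map (ext_id ext_nat) ce1) H); split.
  by move=> m q; have := Ha (m, e q); rewrite /= /bar_map_fun/= eK.
by move=> [m [q t]]; have := Hb (m, (e q, t)); rewrite /= /bar_map_fun/= eK.
Qed.

(** The interval with coordinate [j] consists of parameters, the one with
    coordinate [t] is that of the homotopy to be lifted. *)
Section PathLift.
Variables (X : extSpace).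
Local Notation T := (ch_prod I I).
Variables (g : extMap (bar_prod X I) Y) (h : extMap (bar_prod X T) Z).

Hypothesis gh : forall x j, p (g (x, j)) = h (x, (j, I0 R)).

Definition lift_path (x : X) (c : T -> Y) : Prop :=
  (forall j, c (j, I0 R) = g (x, j)) /\ (forall t, p (c t) = h (x, t)).

Local Notation E := (path_space lift_path).

Section Problem.
Variables (n : nat) (a : extMap (bar_prod ext_nat (sphere R n)) E)
  (b : extMap (bar_prod ext_nat (disc R n)) X).
Hypothesis ab : path_proj lift_path \o a =1 b \o gen_cof R n.
Local Notation D := (disc R n).

Lemma base_a m s : path_base (a (m, s)) = b (m, sphere_to_disc s).
Proof. exact: (ab (m, s)). Qed.

(** The map that [a] and [b] define on the bottom, where a solution is
    prescribed by [g], and on the side, where it is given by [a]. Elsewhere the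
    value is immaterial. *)
Definition corner (m : nat) (c : D * T) : Y :=
  match pselect (sphere_set (set_val c.1)) with
  | left s =>
    path_ev (a (m, exist (fun x => x \in @sphere_set R n) _ (mem_set s))) c.2
  | right _ => g (b (m, c.1), c.2.1)
  end.

Lemma corner_side m c (s : sphere R n) :
  c.1 = sphere_to_disc s -> corner m c = path_ev (a (m, s)) c.2.
Proof.
move=> cs; rewrite /corner; case: pselect => [s'|[]]; last first.
  by rewrite cs; exact: (set_valP s).
congr (path_ev (a (m, _)) _); apply: val_inj => /=.
by rewrite cs.
Qed.

Lemma corner_bottom m c : c.2.2 = I0 R -> corner m c = g (b (m, c.1), c.2.1).
Proof.
move=> c0; rewrite /corner; case: pselect => // s.
set s' := exist _ _ _; have [+ _] := path_spaceP (a (m, s')).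
move=> /(_ c.2.1); rewrite -{1}c0 -surjective_pairing => ->.
congr (g (_, _)); rewrite base_a; congr (b (m, _)).
exact: val_inj.
Qed.

Definition bottom : set (D * T) :=
  [set c | norm2 (set_val c.1) <= 1 - set_val c.2.2 / 2].

Definition side : set (D * T) :=
  [set c | 1 - set_val c.2.2 / 2 <= norm2 (set_val c.1)].

Lemma bottom_side : bottom `|` side = setT.
Proof. by apply/seteqP; split=> // c _; exact/orP/le_total. Qed.

Let slope_continuous : continuous (fun c : D * T =>
  norm2 (set_val c.1) - (1 - set_val c.2.2 / 2)).
Proof.
apply: contB.
  apply: continuousC (@norm2_continuous R n).
  exact: continuousC (@fst_continuous _ _) (@set_val_continuous _ _).
apply: contB; first exact: cst_continuous.
apply: contM; last exact: cst_continuous.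
by apply: contI; exact: continuousC (@snd_continuous _ _) (@snd_continuous _ _).
Qed.

Lemma closed_bottom : closed bottom.
Proof.
rewrite (_ : bottom = (fun c : D * T =>
  norm2 (set_val c.1) - (1 - set_val c.2.2 / 2)) @^-1` [set x | x <= 0]).
  exact: continuous_pre_closed slope_continuous (@closed_le _ 0).
by apply/seteqP; split=> c; rewrite /bottom/= subr_le0.
Qed.

Lemma closed_side : closed side.
Proof.
rewrite (_ : side = (fun c : D * T =>
  norm2 (set_val c.1) - (1 - set_val c.2.2 / 2)) @^-1` [set x | 0 <= x]).
  exact: continuous_pre_closed slope_continuous (@closed_ge _ 0).
by apply/seteqP; split=> c; rewrite /side/= subr_ge0.
Qed.

Definition start (c : D * T) : D * T := flow (c, I0 R).

Lemma start_continuous : continuous start.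
Proof.
apply: (@continuousC _ _ _ (fun c => (c, I0 R))); last exact: flow_continuous.
by apply: pair_continuous; [exact: id_continuous|exact: cst_continuous].
Qed.

Definition start_map (q : bar_prod ext_nat (ch_prod D T)) : Y :=
  corner q.1 (start q.2).

(** The exit point lies on the bottom or on the side according to which term of
    the gauge dominates; both conditions are closed, so that the two formulas
    for [corner] can be pasted. *)
Lemma start_map_continuous : continuous start_map.
Proof.
pose snd2 := @snd nat (D * T)%type.
have csnd : continuous snd2 by exact: snd_continuous.
apply: (@continuous_pasting _ _ (snd2 @^-1` bottom) (snd2 @^-1` side)).
- exact: continuous_pre_closed csnd closed_bottom.
- exact: continuous_pre_closed csnd closed_side.
- by rewrite -preimage_setU bottom_side preimage_setT.
- set A := _ @^-1` _.
  have cv := @set_val_continuous _ A.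
  have cs : continuous (fun q : A => start (set_val q).2).
    exact: continuousC (continuousC cv csnd) start_continuous.
  rewrite (_ : _ \o _ = fun q : A =>
      g (b ((set_val q).1, (start (set_val q).2).1), (start (set_val q).2).2.1)).
    apply: (@continuousC _ _ _ (fun q : A =>
      (b ((set_val q).1, (start (set_val q).2).1), (start (set_val q).2).2.1)) g);
      last exact: (@ext_fun_continuous _ _ g).
    apply: pair_continuous; last first.
      exact: continuousC (continuousC cs (@snd_continuous _ _)) (@fst_continuous _ _).
    apply: (@continuousC _ _ _ (fun q : A =>
      ((set_val q).1, (start (set_val q).2).1)) b);
      last exact: (@ext_fun_continuous _ _ b).
    apply: pair_continuous; first exact: continuousC cv (@fst_continuous _ _).
    exact: continuousC cs (@fst_continuous _ _).
  apply/funext => q /=; rewrite /start_map corner_bottom//.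
  by apply: flow_start_bottom; exact: (set_valP q).
- set A := _ @^-1` _.
  have cv := @set_val_continuous _ A.
  have cs : continuous (fun q : A => start (set_val q).2).
    exact: continuousC (continuousC cv csnd) start_continuous.
  have side_sphere (q : A) : sphere_set (set_val (start (set_val q).2).1).
    by apply: flow_start_side; exact: (set_valP q).
  pose k (q : A) : sphere R n :=
    exist (fun x => x \in @sphere_set R n) _ (mem_set (side_sphere q)).
  have ck : continuous k.
    apply: to_set_type_continuous.
    exact: continuousC (continuousC cs (@fst_continuous _ _)) (@set_val_continuous _ _).
  rewrite (_ : _ \o _ = fun q : A =>
      path_ev (a ((set_val q).1, k q)) (start (set_val q).2).2).
    apply: (@continuousC _ _ _ (fun q : A =>
      (a ((set_val q).1, k q), (start (set_val q).2).2)) _ _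
      (@path_ev_continuous _ _ _ lift_path)).
    apply: pair_continuous; last exact: continuousC cs (@snd_continuous _ _).
    apply: (@continuousC _ _ _ (fun q : A => ((set_val q).1, k q)) a);
      last exact: (@ext_fun_continuous _ _ a).
    by apply: pair_continuous => //; exact: continuousC cv (@fst_continuous _ _).
  apply/funext => q /=; rewrite /start_map (@corner_side _ _ (k q))//.
  exact: val_inj.
Qed.

Lemma start_map_exterior F : exterior F ->
  exists2 G, exterior G & G `<=` start_map @^-1` F.
Proof.
move=> eF.
have [F1 eF1 sF1] := compact_bar_exterior (ext_fun_exterior g eF).
have [F2 eF2 sF2] := compact_bar_exterior (ext_fun_exterior b eF1).
have [F3 eF3 sF3] := compact_bar_exterior
  (ext_fun_exterior a (path_box_exterior lift_path (exteriorT X) eF)).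
exists (fst @^-1` (F2 `&` F3)); first exact/bar_fst_exterior/exteriorI.
move=> [m c] [/= F2m F3m]; rewrite /start_map/=.
rewrite /corner; case: pselect => [s|_].
  by have [_] := sF3 m (exist (fun x => x \in @sphere_set R n) _ (mem_set s)) F3m.
exact/sF1/sF2.
Qed.

Definition start_ext := mk_ext start_map_continuous start_map_exterior.

Definition base_ext : extMap (bar_prod ext_nat (ch_prod D T)) Z :=
  ext_comp (ext_comp (bar_assoc _ _ _) (bar_map b (@id_continuous T))) h.

Lemma corner_base m c : c.2.2 = I0 R \/ sphere_set (set_val c.1) ->
  p (corner m c) = base_ext (m, c).
Proof.
move=> [c0|s].
  by rewrite corner_bottom// gh -c0 /= -surjective_pairing.
pose s' : sphere R n := exist (fun x => x \in @sphere_set R n) _ (mem_set s).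
have cs : c.1 = sphere_to_disc s' by exact: val_inj.
rewrite (@corner_side _ _ s')// /= /bar_map_fun/= cs -base_a.
by have [_] := path_spaceP (a (m, s')).
Qed.

Lemma start_corner c : (start c).2.2 = I0 R \/ sphere_set (set_val (start c).1).
Proof.
have [le|/ltW le] := leP (norm2 (set_val c.1)) (1 - set_val c.2.2 / 2).
  by left; exact: flow_start_bottom.
by right; exact: flow_start_side.
Qed.

(** The values on the bottom and the side, spread along the flow, form a lifting
    problem of the kind B x {0} -> B x I; its solution is read off at
    [flow_time]. *)
Lemma corner_extension : exists F : extMap (bar_prod ext_nat (ch_prod D T)) Y,
  (forall m c, c.2.2 = I0 R \/ sphere_set (set_val c.1) -> F (m, c) = corner m c) /\
  p \o F =1 base_ext.
Proof.
have cf : continuous (@flow R n : ch_prod (ch_prod D T) I -> ch_prod D T).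
  exact: flow_continuous.
have [m q|H [Hs Hb]] := @fibration_retract_lift (ch_prod D T) n.+2 start_ext
  (ext_comp (bar_map (ext_id ext_nat) cf) base_ext)
  (retract_disc_square R n).
  exact: corner_base (start_corner q).
have ct : continuous (fun c : ch_prod D T => (c, flow_time c) : ch_prod (ch_prod D T) I).
  apply: pair_continuous; first exact: id_continuous.
  exact: flow_time_continuous.
exists (ext_comp (bar_map (ext_id ext_nat) ct) H); split=> [m c c0|[m c]].
  have t0 : flow_time c = I0 R.
    by case: c0 => [/flow_time_bottom|/flow_time_side].
  rewrite /= /bar_map_fun/= t0 Hs /= /start_map /start/=.
  by rewrite -{1}t0 flow_end.
by rewrite -[in RHS](flow_end c); exact: (Hb (m, (c, flow_time c))).
Qed.

Lemma path_lift : exists H : extMap (bar_prod ext_nat D) E,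
  H \o gen_cof R n =1 a /\ path_proj lift_path \o H =1 b.
Proof.
have [F [Fc Fb]] := corner_extension.
have PF w : lift_path (b w) (fun t => F (w.1, (w.2, t))).
  case: w => m x; split=> [j|t]; last exact: (Fb (m, (x, t))).
  by rewrite Fc ?corner_bottom//; left.
pose F' := ext_comp (bar_assocV ext_nat D T) F.
exists (@curry_path _ _ _ lift_path _ b F' PF); split=> // -[m s].
apply: path_ext => [|t]; first by rewrite base_a.
rewrite /path_ev/= /bar_map_fun/= Fc; last by right; exact: (set_valP s).
by rewrite (@corner_side _ _ s).
Qed.

End Problem.

Lemma path_proj_trivial_fibration : trivial_fibration R (path_proj lift_path).
Proof. by move=> n a b ab; exact: path_lift. Qed.

(** A lift of the identity of X through E -> X that extends the one given on A
    is the adjoint of the required homotopy. *)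
Lemma relative_homotopy_lifting (A : extSpace) (i : extMap A X)
    (k : extMap (bar_prod A T) Y) :
  cofibration R i ->
  (forall x j, k (x, (j, I0 R)) = g (i x, j)) ->
  (forall x t, p (k (x, t)) = h (i x, t)) ->
  exists H : extMap (bar_prod X T) Y,
    [/\ forall x j, H (x, (j, I0 R)) = g (x, j),
        forall x t, H (i x, t) = k (x, t) & p \o H =1 h].
Proof.
move=> ci kg kh.
have [//|s [si sX]] := ci _ _ _ path_proj_trivial_fibration
  (@curry_path _ _ _ lift_path _ i k (fun x => conj (kg x) (kh x))) (ext_id X).
have cev : continuous (fun q : bar_prod X T => path_ev (s q.1) q.2).
  apply: (@continuousC _ _ _ (fun q => (s q.1, q.2)) _ _
    (@path_ev_continuous _ _ _ lift_path)).
  apply: pair_continuous; last exact: snd_continuous.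
  exact: continuousC (@fst_continuous _ _) (@ext_fun_continuous _ _ s).
have eev F : exterior F -> exists2 G, exterior G &
    G `<=` (fun q : bar_prod X T => path_ev (s q.1) q.2) @^-1` F.
  move=> eF; exists (fst @^-1` (s @^-1` path_box setT F)).
    apply/bar_fst_exterior/ext_fun_exterior/path_box_exterior => //.
    exact: exteriorT.
  by move=> [x t] [_ +]; exact.
exists (mk_ext cev eev); split=> [x j|x t|[x t]] /=.
- by have [/(_ j)] := path_spaceP (s x); rewrite (sX x : path_base (s x) = x).
- by rewrite (si x : s (i x) = _).
- have [_ /(_ t)] := path_spaceP (s x).
  by rewrite (sX x : path_base (s x) = x).
Qed.

End PathLift.
End Fibration.

(** * Convexity of the half-line *)

Section HalfLineConvexity.
Variable R : realType.
Local Notation I := (I01 R).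

Lemma Rplus_ge0 (u : Rplus R) : 0 <= set_val u :> R.
Proof. by have := set_valP u; rewrite /half_line/= in_itv/= andbT. Qed.

Lemma to_half_line_subproof (x : R) : half_line (Num.max 0 x).
Proof. by rewrite /half_line/= in_itv/= andbT le_max lexx. Qed.

Definition to_half_line (x : R) : Rplus R :=
  exist (fun y : R => y \in @half_line R) _ (mem_set (to_half_line_subproof x)).

Lemma val_posp x : set_val (to_half_line x) = Num.max 0 x.
Proof. by []. Qed.

Lemma to_half_lineK (u : Rplus R) : to_half_line (set_val u) = u.
Proof. by apply: val_inj; rewrite -!set_valE val_posp max_r ?Rplus_ge0. Qed.

Lemma to_half_line_continuous : continuous to_half_line.
Proof.
apply: to_set_type_continuous.
apply: (@cont_max R _ (fun=> 0) (fun x : R => x)); first exact: cst_continuous.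
exact: id_continuous.
Qed.

Definition tail (M : R) : set (Rplus R) := [set u | M < set_val u].

Lemma tail_exterior M : exterior (tail M).
Proof.
exists (~` tail M); split; last by rewrite setCK.
- apply: open_closedC; apply: continuous_pre_open (@open_gt _ M).
  exact: set_val_continuous.
- rewrite (_ : ~` _ = to_half_line @` `[0, M]).
    apply: continuous_compact; last exact: segment_compact.
    exact/continuous_subspaceT/to_half_line_continuous.
  apply/seteqP; split=> [u /negP|_ [x /= + <-]].
    rewrite -leNgt => uM; exists (set_val u); last exact: to_half_lineK.
    by rewrite /= in_itv/= Rplus_ge0.
  rewrite in_itv/= => /andP[x0 xM]; apply/negP.
  by rewrite -leNgt val_posp max_r.
Qed.

Lemma exterior_tail (F : set (Rplus R)) : exterior F -> exists M, tail M `<=` F.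
Proof.
move=> [K [_ cK ->]].
have /compact_bounded[M [_ MK]] : compact (set_val @` K : set R).
  by apply: continuous_compact => //; exact/continuous_subspaceT/set_val_continuous.
exists (M + 1) => u /= Mu Ku.
have /= : (`|set_val u| <= M + 1 :> R).
  by apply: (MK (M + 1)); [rewrite ltrDl|exists u].
by rewrite ger0_norm ?Rplus_ge0// leNgt Mu.
Qed.

(** A convex combination of two numbers greater than M is greater than M; by
    [exterior_tail] this makes linear homotopies exterior. *)
Section Linear.
Variables (W : extSpace) (a b : extMap W (Rplus R)).

Definition lin_val (q : bar_prod W I) : R :=
  (1 - set_val q.2) * set_val (a q.1) + set_val q.2 * set_val (b q.1).

Definition lin_fun (q : bar_prod W I) : Rplus R := to_half_line (lin_val q).

Lemma lin_continuous : continuous lin_fun.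
Proof.
have cv (c : extMap W (Rplus R)) :
    continuous (fun q : bar_prod W I => set_val (c q.1) : R).
  apply: continuousC (@set_val_continuous _ _).
  exact: continuousC (@fst_continuous _ _) (@ext_fun_continuous _ _ c).
have ct : continuous (fun q : bar_prod W I => set_val q.2 : R).
  by apply: contI; exact: snd_continuous.
apply: continuousC to_half_line_continuous; apply: contD; apply: contM => //.
by apply: contB => //; exact: cst_continuous.
Qed.

Lemma lin_exterior F : exterior F -> exists2 G, exterior G & G `<=` lin_fun @^-1` F.
Proof.
move=> /exterior_tail[M sM].
exists (fst @^-1` (a @^-1` tail M `&` b @^-1` tail M)).
  apply: bar_fst_exterior.
  by apply: exteriorI; apply: ext_fun_exterior; exact: tail_exterior.
move=> [w t] [/= aM bM]; apply: sM; rewrite /tail/= lt_max; apply/orP; right.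
rewrite /lin_val/=; move: aM bM; rewrite /tail/=.
have := I01_ge0 t; have := I01_le1 t.
move: (set_val t) (set_val (a w)) (set_val (b w)) => s x y *.
by have [|] := leP x y; nra.
Qed.

Definition lin : extMap (bar_prod W I) (Rplus R) := mk_ext lin_continuous lin_exterior.

Lemma lin0 w : lin (w, I0 R) = a w.
Proof. by rewrite /= /lin_fun /lin_val/= subr0 mul1r mul0r addr0 to_half_lineK. Qed.

Lemma lin1 w : lin (w, I1 R) = b w.
Proof. by rewrite /= /lin_fun /lin_val/= subrr mul1r mul0r add0r to_half_lineK. Qed.

Lemma lin_diag w t : a w = b w -> lin (w, t) = a w.
Proof.
by move=> ab; rewrite /= /lin_fun /lin_val/= ab -mulrDl subrK mul1r to_half_lineK.
Qed.

End Linear.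
End HalfLineConvexity.

(** * Homotopies under and over the half-line *)

Section Homotopies.
Variables (R : realType) (X Y : extStar R).
Local Notation I := (I01 R).

Lemma under_homotopic_refl (f : underMap X Y) : under_homotopic f f.
Proof.
exists (ext_comp (bar_fst X I) f); split=> // t u; exact: under_sec.
Qed.

Lemma under_homotopic_sym (f g : underMap X Y) :
  under_homotopic f g -> under_homotopic g f.
Proof.
move=> [H [H0 H1 Hs]].
have cr : continuous (fun t : I => clamp (1 - set_val t)).
  apply: cont_clamp; apply: contB; first exact: cst_continuous.
  by apply: contI; exact: id_continuous.
exists (ext_comp (bar_map (ext_id X) cr) H).
split=> [x|x|t u]; rewrite /= /bar_map_fun/= ?Hs//.
- by rewrite subr0 clamp_ge1// H1.
- by rewrite subrr clamp_le0// H0.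
Qed.

Lemma under_homotopic_trans (f g k : underMap X Y) :
  under_homotopic f g -> under_homotopic g k -> under_homotopic f k.
Proof.
move=> [H [H0 H1 Hs]] [K [K0 K1 Ks]].
pose l (t : I) := clamp (2 * set_val t).
pose r (t : I) := clamp (2 * set_val t - 1).
have cl : continuous l.
  apply: cont_clamp; apply: contM; first exact: cst_continuous.
  by apply: contI; exact: id_continuous.
have cr : continuous r.
  apply: cont_clamp; apply: contB; last exact: cst_continuous.
  apply: contM; first exact: cst_continuous.
  by apply: contI; exact: id_continuous.
pose H' := ext_comp (bar_map (ext_id X) cl) H.
pose K' := ext_comp (bar_map (ext_id X) cr) K.
pose c (q : bar_prod X I) : Y := if set_val q.2 <= 2^-1 then H' q else K' q.
have cc : continuous c.
  have ct : continuous (fun q : bar_prod X I => set_val q.2 : R).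
    by apply: contI; exact: snd_continuous.
  apply: (@continuous_pasting _ _
    [set q : bar_prod X I | set_val q.2 <= 2^-1] [set q | 2^-1 <= set_val q.2]).
  - exact: continuous_pre_closed ct (@closed_le _ _).
  - exact: continuous_pre_closed ct (@closed_ge _ _).
  - by apply/seteqP; split=> // q _; exact/orP/le_total.
  - rewrite (_ : _ \o _ = H' \o set_val).
      exact: continuousC (@set_val_continuous _ _) (@ext_fun_continuous _ _ H').
    by apply/funext => q /=; rewrite /c (set_valP q : _ <= _).
  - rewrite (_ : _ \o _ = K' \o set_val).
      exact: continuousC (@set_val_continuous _ _) (@ext_fun_continuous _ _ K').
    apply/funext => q; rewrite /= /c; case: ifP => // q1.
    have q2 : set_val (set_val q).2 = 2^-1 :> R.
      by apply/le_anti; rewrite q1; exact: (set_valP q).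
    rewrite /H' /K' /= /bar_map_fun /l /r/= q2 mulfV ?pnatr_eq0//.
    by rewrite clamp_ge1// subrr clamp_le0// H1 K0.
have ec F : exterior F -> exists2 G, exterior G & G `<=` c @^-1` F.
  move=> eF; exists (H' @^-1` F `&` K' @^-1` F).
    by apply: exteriorI; exact: ext_fun_exterior.
  by move=> q [HF KF]; rewrite /preimage/= /c; case: ifP.
exists (mk_ext cc ec); split=> [x|x|t u]; rewrite /= /c/=.
- by rewrite invr_ge0 ler0n /H' /= /bar_map_fun /l/= mulr0 clamp_le0// H0.
- rewrite invr_ge1 ?unitfE ?ltr0n ?pnatr_eq0//.
  rewrite (_ : 2%:R <= 1 = false) ?lern1//.
  by rewrite /K' /= /bar_map_fun /r/= mulr1 clamp_ge1 ?K1//; lra.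
- by case: ifP => _; [exact: Hs|exact: Ks].
Qed.

(** The universal property of the pushout defining the cylinder: morphisms out
    of it are homotopies through morphisms. *)
Lemma star_homotopicP (f g : starMap X Y) : star_homotopic f g <->
  exists H : extMap (bar_prod X I) Y,
    [/\ forall x, H (x, I0 R) = f x, forall x, H (x, I1 R) = g x,
        forall t u, H (sec X u, t) = sec Y u &
        forall x t, ret Y (H (x, t)) = ret X x].
Proof.
split=> [[h hfg]|[H [H0 H1 Hs Hr]]].
  exists (ext_comp (tensor_in X I) h); split=> [x|x|t u|x t].
  - by have [] := hfg x.
  - by have [] := hfg x.
  - rewrite -(under_sec h u); congr (h _).
    exact: (proj1 (pushoutP (tensor_sxid X I) (tensor_proj R I)) (u, t)).
  - rewrite -[LHS]/((ret Y \o h) (tensor_in X I (x, t))) star_ret.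
    exact: (po_rec_inl (@tensor_ret_compat R X I)).
have Hc : H \o tensor_sxid X I =1 sec Y \o tensor_proj R I.
  by move=> [u t]; exact: Hs.
pose h : extMap (cylinder X) Y := po_rec Hc.
have hs : h \o sec (cylinder X) =1 sec Y by move=> u; exact: (po_rec_inr Hc).
have hr : ret Y \o UnderMap hs =1 ret (cylinder X).
  move=> q; rewrite -[q]po_reprK; case: (po_repr q) => [[x t]|u].
    transitivity (ret X x); last first.
      by symmetry; exact: (po_rec_inl (@tensor_ret_compat R X I)).
    by rewrite -(Hr x t); congr (ret Y _); exact: (po_rec_inl Hc).
  transitivity u; last first.
    by symmetry; exact: (po_rec_inr (@tensor_ret_compat R X I)).
  by rewrite -[RHS](ret_sec Y); congr (ret Y _); exact: (po_rec_inr Hc).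
exists (StarMap hr) => x; rewrite -H0 -H1; split; exact: (po_rec_inl Hc).
Qed.

Hypotheses (cX : cofibrant X) (fY : fibrant Y).
Local Notation T := (ch_prod I I).

Lemma lift_over_halfline (g : extMap (bar_prod X I) Y)
    (h : extMap (bar_prod X T) (Rplus R)) :
  (forall u j, g (sec X u, j) = sec Y u) ->
  (forall x j, ret Y (g (x, j)) = h (x, (j, I0 R))) ->
  (forall u t, h (sec X u, t) = u) ->
  exists H : extMap (bar_prod X T) Y,
    [/\ forall x j, H (x, (j, I0 R)) = g (x, j),
        forall u t, H (sec X u, t) = sec Y u &
        forall q, ret Y (H q) = h q].
Proof.
move=> gs gh hs.
have [u j|u t|H [H0 Hs Hr]] :=
  @relative_homotopy_lifting R Y (Rplus R) (ret Y) fY X g h gh (Rplus R) (sec X)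
    (ext_comp (bar_fst (Rplus R) T) (sec Y)) cX.
- by rewrite gs.
- by rewrite hs; exact: ret_sec.
by exists H.
Qed.

(** The end of a lift of the linear homotopy from ret Y o g to ret X. *)
Lemma under_to_star (g : underMap X Y) :
  exists f : starMap X Y, under_homotopic f g.
Proof.
have cs : continuous (@snd I I) by exact: snd_continuous.
pose h := ext_comp (bar_map (ext_id X) (cs : continuous (@snd I I : T -> I)))
  (lin (ext_comp g (ret Y)) (ret X)).
have [u j|x j|u t|H [H0 Hs Hr]] :=
  @lift_over_halfline (ext_comp (bar_fst X I) g) h.
- exact: under_sec.
- by rewrite [RHS]lin0.
- have e : ext_comp g (ret Y) (sec X u) = ret X (sec X u).
    rewrite [RHS]ret_sec -[RHS](ret_sec Y); congr (ret Y _).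
    exact: (under_sec g).
  by rewrite [LHS]lin_diag// e; exact: (ret_sec X).
pose j0 (t : I) : T := (I0 R, t).
have cj0 : continuous j0.
  by apply: pair_continuous; [exact: cst_continuous|exact: id_continuous].
pose K := ext_comp (bar_map (ext_id X) cj0) H.
pose f := ext_comp (bar_slice X (I1 R)) K.
have fs : f \o sec X =1 sec Y by move=> u; exact: Hs.
have fr : ret Y \o UnderMap fs =1 ret X.
  by move=> x; rewrite [LHS]Hr [LHS]lin1.
exists (StarMap fr); apply: under_homotopic_sym.
by exists K; split=> [x|x|t u] //; [exact: H0|exact: Hs].
Qed.

(** The linear homotopy from ret Y o G to the constant homotopy at ret X is
    constant over the two ends of G, which are morphisms. So its lift H on the
    square lies over the half-line on the sides j = 0, t = 1 and j = 1. *)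
Lemma under_to_star_homotopic (f g : starMap X Y) :
  under_homotopic f g -> star_homotopic f g.
Proof.
move=> [G [G0 G1 Gs]]; apply/star_homotopicP.
pose h := ext_comp (bar_assoc X I I)
  (lin (ext_comp G (ret Y)) (ext_comp (bar_fst X I) (ret X))).
have [x j|u [j t]|H [H0 Hs Hr]] := @lift_over_halfline G h (fun u j => Gs j u).
- by rewrite [RHS]lin0.
- have e : ext_comp G (ret Y) (sec X u, j) =
      ext_comp (bar_fst X I) (ret X) (sec X u, j).
    by rewrite /= Gs; rewrite [LHS]ret_sec [RHS]ret_sec.
  by rewrite [LHS]lin_diag// e; exact: (ret_sec X).
(* The path (0,0) -> (0,1) -> (1,1) -> (1,0), one side for each third of I. *)
pose c (s : I) : T :=
  (clamp (3 * set_val s - 1), clamp (Num.min (3 * set_val s) (3 - 3 * set_val s))).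
have cc : continuous c.
  have c3 : continuous (fun s : I => 3 * set_val s : R).
    apply: contM; first exact: cst_continuous.
    by apply: contI; exact: id_continuous.
  apply: pair_continuous; apply: cont_clamp.
    by apply: contB => //; exact: cst_continuous.
  by apply: cont_min => //; apply: contB => //; exact: cst_continuous.
exists (ext_comp (bar_map (ext_id X) cc) H); split=> [x|x|t u|x s].
- rewrite /= /bar_map_fun /c/= mulr0 clamp_le0; last by lra.
  by rewrite clamp_le0 ?ge_min ?lexx// H0 G0.
- rewrite /= /bar_map_fun /c/= mulr1 clamp_ge1; last by lra.
  by rewrite subrr clamp_le0 ?ge_min ?lexx ?orbT// H0 G1.
- exact: Hs.
rewrite [LHS]Hr /= /bar_map_fun/= /c.
have [s1|s1] := leP (3 * set_val s : R) 1.
  rewrite clamp_le0 ?subr_le0// [LHS]lin_diag//= G0; exact: star_ret.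
have [s2|s2] := leP 2 (3 * set_val s : R).
  rewrite clamp_ge1; last by lra.
  rewrite [LHS]lin_diag//= G1; exact: star_ret.
rewrite (@clamp_ge1 _ (Num.min _ _)); first exact: lin1.
by rewrite le_min; apply/andP; split; lra.
Qed.

Lemma star_homotopic_under (f g : starMap X Y) :
  star_homotopic f g <-> under_homotopic f g.
Proof.
split; last exact: under_to_star_homotopic.
by move=> /star_homotopicP[H [H0 H1 Hs _]]; exists H.
Qed.

End Homotopies.

(** * Passage to homotopy classes *)

Section Classes.
Variables (S : Type) (e : S -> S -> Prop).

Lemma class_ofP (x y : S) : (forall x, e x x) ->
  (forall x y, e x y -> e y x) -> (forall x y z, e x y -> e y z -> e x z) ->
  class_of e x = class_of e y <-> e x y.
Proof.
move=> re se te; split=> [xy|xy].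
  have exy : [set z | e x z] = [set z | e y z] := congr1 (@set_val _ _) xy.
  by rewrite -[e x y]/([set z | e x z] y) exy; exact: re.
apply: val_inj; apply/seteqP; split=> z /=; first exact/te/se.
exact: te.
Qed.

Lemma class_of_surj (c : classes e) : exists x, class_of e x = c.
Proof.
have [x _ xc] := set_valP c; exists x; exact: val_inj.
Qed.

End Classes.

Theorem proposition3p8 (R : realType) (X Y : extStar R) :
  cofibrant X -> fibrant Y ->
  exists2 phi : star_classes X Y -> under_classes X Y,
    forall f : starMap X Y, phi (star_class f) = under_class (star_under f) &
    bijective phi.
Proof.
move=> cX fY.
have underP (f g : underMap X Y) :
    under_class f = under_class g <-> under_homotopic f g.
  apply: class_ofP; [exact: under_homotopic_refl|exact: under_homotopic_sym|].
  exact: under_homotopic_trans.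
have starP (f g : starMap X Y) :
    star_class f = star_class g <-> under_homotopic f g.
  rewrite -(star_homotopic_under cX fY); apply: class_ofP => [k|k l|k l m];
    rewrite !(star_homotopic_under cX fY).
  - exact: under_homotopic_refl.
  - exact: under_homotopic_sym.
  - exact: under_homotopic_trans.
have [rep repK] : {rep : star_classes X Y -> starMap X Y &
    forall c, star_class (rep c) = c} := choice (@class_of_surj _ _).
have [lift liftK] : {lift : under_classes X Y -> starMap X Y &
    forall c, under_class (lift c) = c}.
  apply: (@choice _ _ (fun c (f : starMap X Y) => under_class f = c)) => c.
  have [g gc] := class_of_surj c.
  have [f fg] := under_to_star cX fY g.
  by exists f; rewrite -gc; exact/underP.
have phiE f : under_class (rep (star_class f)) = under_class f.
  by apply/underP/starP; rewrite repK.
exists (fun c => under_class (rep c)) => //.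
exists (fun c => star_class (lift c)) => c; last by rewrite phiE liftK.
by rewrite -[RHS]repK; apply/starP/underP; rewrite liftK.
Qed.
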